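(* Let $(\mathcal{M},\mu)$ be a measure space, let $(A,\mathrm{Dom}(A))$ be a nonnegative selfadjoint operator on $L^2=L^2(\mathcal{M},d\mu)$, and let $\theta\in C_0^0(\mathbb{R})$ be such that $\theta\equiv 1$ on $[-c,c]$, where $c>0$. Then for all $s>0$, $\sigma>0$, setting $$p:=\frac{2(\sigma+s)}{\sigma},$$ we have $$\|u\|_{L^p}\leq C\,\|u\|_{\dot{B}_A^{-\sigma}}^{1-\frac{2}{p}}\,\|u\|_{\dot{H}_A^s}^{\frac{2}{p}}$$ for all $u\in\mathrm{Dom}(A^s)$ such that $\|u\|_{\dot{B}_A^{-\sigma}}$ is finite, where the constant is explicitly given by $$C=2\,\|1-\theta\|_{L^\infty}^{\frac{2}{p}}\left(\frac{p}{p-2}\right)^{1/p}\left(\frac{2}{c}\right)^{\sigma\frac{p-2}{p}}.$$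
   Context: For $p\in[1,\infty]$, $L^p=L^p(\mathcal{M},d\mu)$. $C_0^0(\mathbb{R})$ denotes the continuous compactly supported functions on $\mathbb{R}$. The operators $A^s$ and $\theta(2^{-k}A)$ are defined by the spectral theorem (functional calculus) for the selfadjoint operator $A$. For $s>0$ and $u\in\mathrm{Dom}(A^s)$, $$\|u\|_{\dot{H}_A^s}:=\|A^s u\|_{L^2}.$$ For $\sigma\geq 0$, $$\|u\|_{\dot{B}_A^{-\sigma}}:=\sup_{k\in\mathbb{Z}}2^{-k\sigma}\|\theta(2^{-k}A)u\|_{L^\infty},$$ considered on the subspace of those $u\in L^2$ for which this quantity is finite. *)

(* Defs.v *)
From HB Require Import structures.
From mathcomp Require Import all_boot all_order all_algebra.
From mathcomp Require Import complex.
From mathcomp Require Import all_classical all_reals all_analysis.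

Set Implicit Arguments.
Unset Strict Implicit.
Unset Printing Implicit Defensive.
Import Order.TTheory GRing.Theory Num.Theory.
Import numFieldNormedType.Exports.
Local Open Scope classical_set_scope.
Local Open Scope ring_scope.
Local Open Scope complex_scope.

(* Elements of the complex Hilbert space L^2(T, mu) are represented by
   functions u : T -> R[i] satisfying [L2 mu u], and equality in L^2 is
   equality mu-almost everywhere. *)
Section complex_Lp.
Context {d : measure_display} {T : measurableType d} {R : realType}.
Variable mu : {measure set T -> \bar R}.
Implicit Types (p : \bar R) (u v : T -> R[i]).

Definition Lpnorm p u : \bar R :=
  ('N[mu]_p[(fun x => (Normc.normc (u x))%:E)])%E.

Definition L2 : set (T -> R[i]) :=
  [set u | [/\ measurable_fun setT (fun x => complex.Re (u x)),
               measurable_fun setT (fun x => complex.Im (u x)) &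
               (Lpnorm 2%:E u < +oo)%E]].

Definition inner u v : R[i] :=
  (\int[mu]_x complex.Re (u x * conjc (v x)))%R +i*
  (\int[mu]_x complex.Im (u x * conjc (v x)))%R.

End complex_Lp.

Section unbounded_operators.
Context {d : measure_display} {T : measurableType d} {R : realType}.
Variable mu : {measure set T -> \bar R}.
(* The unbounded operator (A, Dom A): A is only meaningful on D = Dom A. *)
Variables (D : set (T -> R[i])) (A : (T -> R[i]) -> (T -> R[i])).
Implicit Types u v w : T -> R[i].

Record is_operator : Prop := IsOperator {
  operator_dom : D `<=` L2 mu ;
  operator_L2 : forall u, D u -> L2 mu (A u) ;
  operator_dom_ae : forall u v, D u -> L2 mu v -> u = v %[ae mu] -> D v ;
  operator_ae : forall u v, D u -> D v -> u = v %[ae mu] ->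
    A u = A v %[ae mu] ;
  operator_dom0 : D (fun=> 0) ;
  operator_dom_lin : forall (a : R[i]) u v, D u -> D v ->
    D (fun x => a * u x + v x) ;
  operator_lin : forall (a : R[i]) u v, D u -> D v ->
    A (fun x => a * u x + v x) = (fun x => a * A u x + A v x) %[ae mu] }.

Definition densely_defined : Prop := forall u (e : R), L2 mu u -> 0 < e ->
  exists2 v, D v & (Lpnorm mu 2%:E (fun x => u x - v x)%R < e%:E)%E.

Definition graph u v : Prop := [/\ D u, L2 mu v & A u = v %[ae mu]].

Definition adjoint_graph v w : Prop :=
  [/\ L2 mu v, L2 mu w & forall u, D u -> inner mu (A u) v = inner mu u w].

Definition selfadjoint : Prop :=
  [/\ is_operator, densely_defined &
      forall v w, graph v w <-> adjoint_graph v w].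

(* In the order of R[i], [0 <= z] says that z is real and nonnegative. *)
Definition nonnegative : Prop := forall u, D u -> 0 <= inner mu (A u) u.

End unbounded_operators.

Section functional_calculus.
Context {d : measure_display} {T : measurableType d} {R : realType}.
Variable mu : {measure set T -> \bar R}.
Implicit Types (u v : T -> R[i]) (B : set R) (f : R -> R[i]).

(* Projection-valued measures on the Borel sets of the real line, with
   countable additivity in the strong operator topology. *)
Record is_pvm (E : set R -> (T -> R[i]) -> (T -> R[i])) : Prop := IsPvm {
  pvm_L2 : forall B u, measurable B -> L2 mu u -> L2 mu (E B u) ;
  pvm_ae : forall B u v, measurable B -> L2 mu u -> L2 mu v ->
    u = v %[ae mu] -> E B u = E B v %[ae mu] ;
  pvm_lin : forall B (a : R[i]) u v, measurable B -> L2 mu u -> L2 mu v ->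
    E B (fun x => a * u x + v x) = (fun x => a * E B u x + E B v x) %[ae mu] ;
  pvm_sym : forall B u v, measurable B -> L2 mu u -> L2 mu v ->
    inner mu (E B u) v = inner mu u (E B v) ;
  pvm_setI : forall B1 B2 u, measurable B1 -> measurable B2 -> L2 mu u ->
    E (B1 `&` B2) u = E B1 (E B2 u) %[ae mu] ;
  pvm_setT : forall u, L2 mu u -> E setT u = u %[ae mu] ;
  pvm_sigma_additive : forall (F : nat -> set R) u,
    (forall n, measurable (F n)) -> trivIset setT F -> L2 mu u ->
    Lpnorm mu 2%:E (fun x => \sum_(i < n) E (F i) u x -
      E (\bigcup_i F i) u x)%R @[n --> \oo] --> (0 : \bar R)%E }.

Variable E : set R -> (T -> R[i]) -> (T -> R[i]).

(* The scalar spectral measure B |-> ||E(B)u||^2 = <E(B)u, u>. *)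
Definition spectral_mass u : set R -> \bar R :=
  fun B => (Lpnorm mu 2%:E (E B u) ^+ 2)%E.

(* A list of pairs (a, B) encodes the simple function \sum a 1_B. *)
Definition simple_fct (l : seq (R[i] * set R)) (t : R) : R[i] :=
  \sum_(q <- l) q.1 * (\1_(q.2) t)%:C.

Definition simple_op (l : seq (R[i] * set R)) u : T -> R[i] :=
  fun x => \sum_(q <- l) q.1 * E q.2 u x.

(* [spectral_integral f u v] says that u lies in the domain of the spectral
   integral f(A) = \int f dE and that f(A)u = v, for f Borel: v is the limit in
   L^2 of (\int f_n dE)u for simple f_n converging to f in
   L^2(spectral_mass u).  Such f_n exist iff \int |f|^2 d(spectral_mass u) is
   finite, and v does not depend on them. *)
Definition spectral_integral f u v : Prop :=
  [/\ L2 mu u, L2 mu v &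
   exists l : nat -> seq (R[i] * set R),
    [/\ forall n q, q \in l n -> measurable q.2,
        (\int[spectral_mass u]_t
           ((Normc.normc (simple_fct (l n) t - f t)) ^+ 2)%:E)%E
          @[n --> \oo] --> (0 : \bar R)%E &
        Lpnorm mu 2%:E (fun x => simple_op (l n) u x - v x)%R
          @[n --> \oo] --> (0 : \bar R)%E]].

(* E is the projection-valued measure that the spectral theorem attaches to
   the selfadjoint operator (A, D), i.e. A = \int t dE(t), domains included. *)
Definition spectral_measure_of (D : set (T -> R[i]))
    (A : (T -> R[i]) -> (T -> R[i])) : Prop :=
  is_pvm E /\
  forall u v, graph mu D A u v <-> spectral_integral (fun t => t%:C) u v.

Definition fcalc_dom f : set (T -> R[i]) :=
  [set u | exists v, spectral_integral f u v].

(* f(A)u; the default value 0 is only used for u outside [fcalc_dom f]. *)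
Definition fcalc f u : T -> R[i] :=
  xget (fun=> 0) [set v | spectral_integral f u v].

(* The function t |-> t^s.  Its values for t < 0 are irrelevant: the spectral
   measure of a nonnegative operator does not charge the negative half-line. *)
Definition power_fct (s t : R) : R[i] := (t `^ s)%:C.

Definition Hdot_norm (s : R) u : \bar R :=
  Lpnorm mu 2%:E (fcalc (power_fct s) u).

Definition Bdot_norm (theta : R -> R[i]) (sigma : R) u : \bar R :=
  ereal_sup (range (fun k : int => (2 `^ (- (k%:~R * sigma)))%:E *
    Lpnorm mu +oo (fcalc (fun t => theta ((2 : R) ^ (- k) * t)%R) u))%E).

End functional_calculus.

(* Main.v *)
Require Import Defs.
From HB Require Import structures.
From mathcomp Require Import all_boot all_order all_algebra.
From mathcomp Require Import complex.
From mathcomp Require Import all_classical all_reals all_analysis.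
From mathcomp Require Import measurable_realfun ess_sup_inf ring lra.
Set Implicit Arguments.
Unset Strict Implicit.
Unset Printing Implicit Defensive.
Import Order.TTheory GRing.Theory Num.Theory.
Import numFieldNormedType.Exports.
Local Open Scope classical_set_scope.
Local Open Scope ring_scope.

(** Write p = q + 2, theta_k = theta(2^-k A), N for the Besov norm of u and
    a_k = 2 N 2^(k sigma). Almost everywhere |theta_k u| <= a_k / 2, so that
    |u| <= 2 |u - theta_k u| wherever |u| >= a_k. Slicing |u|^p along the dyadic
    levels a_k gives the pointwise bound
      |u|^p <= (4 p / q) \sum_k (a_(k+1)^q - a_k^q) |u - theta_k u|^2,
    which needs no Fubini theorem, hence no sigma-finiteness. Integrating, and
    writing m for the spectral measure of u,
      ||u - theta_k u||^2 = \int |1 - theta(2^-k t)|^2 dm(t)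
                         <= ||1 - theta||_oo^2 m(]c 2^k, +oo[),
    because m does not charge the negative half-line; the sum over k then
    telescopes under the integral to at most
      (2 N)^q (2 / c)^(2 s) \int t^(2 s) dm(t)
    up to the factor ||1 - theta||_oo^2. *)

(** The formula for ||u - theta_k u||^2 must be built from the definition: [fcalc] is a choice with
    default value 0 and f(A)u is only a limit of simple operators. So the spectral mass of u is
    first shown to be a finite measure, with an isometry between simple functions in L^2(m) and
    simple operators applied to u; completeness of L^2 then makes theta_k u exist, and the isometry
    passes to the limit. Two gaps need their own argument. The pair (E, A) is linked only by A =
    \int t dE, so the absence of negative spectrum has to be extracted from <Au, u> >= 0. And ||1 -
    theta||_oo is an essential supremum for Lebesgue measure, to which m may be singular; continuity
    of theta turns it into a bound at every point. The levels a_k degenerate when N = 0, so the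
    estimate is proved for every positive N above the Besov norm. The factor 4 is the square of the
    2 in |u| <= 2 |u - theta_k u|; with the 2^q of (2 N)^q it makes 2^p, whose p-th root is the
    leading 2 of C. *)

(** * Squared modulus of complex numbers *)

Section sqnormc.
Context {R : realType}.
Implicit Types z w : R[i].

(** A polynomial in the two coordinates: identities fall to [ring], and measurability needs no
    square root. *)
Definition sqnormc z : R := complex.Re z ^+ 2 + complex.Im z ^+ 2.

Lemma ReD z w : complex.Re (z + w) = complex.Re z + complex.Re w.
Proof. by case: z w => [? ?] []. Qed.
Lemma ImD z w : complex.Im (z + w) = complex.Im z + complex.Im w.
Proof. by case: z w => [? ?] []. Qed.
Lemma ReN z : complex.Re (- z) = - complex.Re z.
Proof. by case: z. Qed.
Lemma ImN z : complex.Im (- z) = - complex.Im z.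
Proof. by case: z. Qed.
Lemma ReM z w : complex.Re (z * w) =
  complex.Re z * complex.Re w - complex.Im z * complex.Im w.
Proof. by case: z w => [? ?] []. Qed.
Lemma ImM z w : complex.Im (z * w) =
  complex.Re z * complex.Im w + complex.Im z * complex.Re w.
Proof. by case: z w => [? ?] []. Qed.
Definition RIE := (ReD, ImD, ReN, ImN, ReM, ImM).

Lemma normc_ge0 z : 0 <= Normc.normc z.
Proof. by case: z => a b; exact: sqrtr_ge0. Qed.

Lemma sqnormc_ge0 z : 0 <= sqnormc z.
Proof. by rewrite addr_ge0// sqr_ge0. Qed.

Lemma normcX2 z : Normc.normc z ^+ 2 = sqnormc z.
Proof. by case: z => a b; rewrite /= sqr_sqrtr// addr_ge0// sqr_ge0. Qed.

Lemma sqnormcN z : sqnormc (- z) = sqnormc z.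
Proof. by rewrite /sqnormc !RIE !sqrrN. Qed.

Lemma sqnormcM z w : sqnormc (z * w) = sqnormc z * sqnormc w.
Proof. by rewrite /sqnormc !RIE; ring. Qed.

Lemma sqnormc0 : sqnormc 0 = 0.
Proof. by rewrite /sqnormc /= expr0n /= addr0. Qed.

(* AM-GM on the cross terms; it replaces Minkowski's inequality. *)
Lemma sqnormcD_le (e : R) z w : 0 < e ->
  sqnormc (z + w) <= (1 + e) * sqnormc z + (1 + e^-1) * sqnormc w.
Proof.
move=> e0; rewrite /sqnormc !RIE.
have H (a b : R) : (a + b) ^+ 2 <= (1 + e) * a ^+ 2 + (1 + e^-1) * b ^+ 2.
  rewrite -subr_ge0.
  suff -> : (1 + e) * a ^+ 2 + (1 + e^-1) * b ^+ 2 - (a + b) ^+ 2 =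
    e^-1 * (e * a - b) ^+ 2.
    by rewrite mulr_ge0 ?sqr_ge0// invr_ge0 ltW.
  by field; rewrite gt_eqF.
have := H (complex.Re z) (complex.Re w); have := H (complex.Im z) (complex.Im w).
lra.
Qed.

Lemma sqnormcD_le2 z w : sqnormc (z + w) <= 2 * sqnormc z + 2 * sqnormc w.
Proof. by have := @sqnormcD_le 1 z w ltr01; rewrite invr1. Qed.

Lemma sqnormcB_comm z w : sqnormc (z - w) = sqnormc (w - z).
Proof. by rewrite -sqnormcN opprB. Qed.

End sqnormc.

(** Early terms may be +oo; the bound for e = 1 already makes the tail finite, so finiteness need
    not be tracked separately. *)
Lemma ge0_cvge0P {R : realType} (x : nat -> \bar R) : (forall n, 0 <= x n)%E ->
  x n @[n --> \oo] --> (0 : \bar R)%E <->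
  forall e : R, 0 < e -> \forall n \near \oo, (x n <= e%:E)%E.
Proof.
move=> x0; split => [/fine_cvgP[xf /cvgr0Pnorm_le h] e e0|h].
  near=> n.
  have xn : x n \is a fin_num by near: n.
  rewrite -(fineK xn) lee_fin (le_trans (ler_norm _))//.
  by near: n; exact: h.
have xf : \forall n \near \oo, x n \is a fin_num.
  by apply: filterS (h 1 ltr01) => n xn; rewrite ge0_fin_numE// (le_lt_trans xn)// ltry.
apply/fine_cvgP; split => //; apply/cvgr0Pnorm_le => e e0.
near=> n.
have xn : x n \is a fin_num by near: n.
rewrite /= ger0_norm ?fine_ge0// -lee_fin fineK//.
by near: n; exact: h.
Unshelve. all: by end_near. Qed.

(** * The space L^2 through the squared norm *)

Section L2_basics.
Context {d : measure_display} {T : measurableType d} {R : realType}.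
Variable mu : {measure set T -> \bar R}.
Implicit Types u v w : T -> R[i].

Definition cmeasurable u :=
  measurable_fun setT (fun x => complex.Re (u x)) /\
  measurable_fun setT (fun x => complex.Im (u x)).

Definition sqnorm u : \bar R := (\int[mu]_x (sqnormc (u x))%:E)%E.

Lemma sqnorm_ge0 u : (0 <= sqnorm u)%E.
Proof. by apply: integral_ge0 => x _; rewrite lee_fin sqnormc_ge0. Qed.

Lemma Lpnorm2E u : Lpnorm mu 2%:E u = (sqnorm u `^ 2^-1)%E.
Proof.
rewrite /Lpnorm unlock /sqnorm; congr (_ `^ _)%E; apply: eq_integral => x _.
by rewrite /= powR_mulrn ?normr_ge0// ger0_norm ?normc_ge0// normcX2.
Qed.

Lemma Lpnorm2_ge0 u : (0 <= Lpnorm mu 2%:E u)%E.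
Proof. exact: Lnorm_ge0. Qed.

Lemma Lpnorm2_sqr u : (Lpnorm mu 2%:E u ^+ 2)%E = sqnorm u.
Proof.
rewrite Lpnorm2E; have := sqnorm_ge0 u.
case: (sqnorm u) => [r| |]//; last first.
  by move=> _; rewrite poweRyr ?invr_neq0// expe2 mulyy.
rewrite lee_fin => r0.
rewrite poweR_EFin -EFin_expe; congr EFin.
by rewrite -powR_mulrn ?powR_ge0// -powRrM mulVf ?powRr1.
Qed.

Lemma sqnorm_lty u : (sqnorm u < +oo)%E = (Lpnorm mu 2%:E u < +oo)%E.
Proof.
rewrite -Lpnorm2_sqr; have := Lpnorm2_ge0 u.
by case: (Lpnorm _ _ _) => [r| |]// _; rewrite -EFin_expe !ltry.
Qed.

Lemma L2P u : L2 mu u <-> cmeasurable u /\ (sqnorm u < +oo)%E.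
Proof.
by split=> [[a b c]|[[a b] c]]; split; rewrite // -?sqnorm_lty// sqnorm_lty.
Qed.

Lemma cmeasurable_sqnormc u : cmeasurable u ->
  measurable_fun setT (fun x => sqnormc (u x)).
Proof. by move=> [a b]; apply: measurable_funD; apply: measurable_funX. Qed.

Lemma cmeasurable_EFin_sqnormc u : cmeasurable u ->
  measurable_fun setT (fun x => (sqnormc (u x))%:E).
Proof. by move=> ?; apply/measurable_EFinP; exact: cmeasurable_sqnormc. Qed.

Lemma cmeasurableD u v : cmeasurable u -> cmeasurable v ->
  cmeasurable (fun x => u x + v x).
Proof.
move=> [a b] [a' b']; split.
  by under eq_fun do rewrite ReD; apply: measurable_funD.
by under eq_fun do rewrite ImD; apply: measurable_funD.
Qed.

Lemma cmeasurableM u v : cmeasurable u -> cmeasurable v ->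
  cmeasurable (fun x => u x * v x).
Proof.
move=> [a b] [a' b']; split.
  by under eq_fun do rewrite ReM; apply: measurable_funB; apply: measurable_funM.
by under eq_fun do rewrite ImM; apply: measurable_funD; apply: measurable_funM.
Qed.

Lemma cmeasurable_cst (z : R[i]) : cmeasurable (fun=> z).
Proof. by split. Qed.

Lemma cmeasurableZ (z : R[i]) u : cmeasurable u -> cmeasurable (fun x => z * u x).
Proof. by apply: cmeasurableM; apply: cmeasurable_cst. Qed.

Lemma cmeasurableN u : cmeasurable u -> cmeasurable (fun x => - u x).
Proof. by move=> /(cmeasurableZ (-1)); under eq_fun do rewrite mulN1r. Qed.

Lemma cmeasurableB u v : cmeasurable u -> cmeasurable v ->
  cmeasurable (fun x => u x - v x).
Proof. by move=> ? ?; apply: cmeasurableD => //; exact: cmeasurableN. Qed.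

Lemma cmeasurable_real (f : T -> R) : measurable_fun setT f ->
  cmeasurable (fun x => (f x)%:C%C).
Proof. by move=> mf; split. Qed.

Lemma eq_sqnorm u v : u =1 v -> sqnorm u = sqnorm v.
Proof. by move=> /funext ->. Qed.

Lemma ae_eq_sqnorm u v : cmeasurable u -> cmeasurable v ->
  u = v %[ae mu] -> sqnorm u = sqnorm v.
Proof.
move=> mu_ mv uv; apply: ae_eq_integral => //.
- exact: cmeasurable_EFin_sqnormc.
- exact: cmeasurable_EFin_sqnormc.
by apply: filterS uv => x /= h /h ->.
Qed.

Lemma sqnormD_le (e : R) u v : cmeasurable u -> cmeasurable v -> 0 < e ->
  (sqnorm (fun x => u x + v x)%R <=
   (1 + e)%:E * sqnorm u + (1 + e^-1)%:E * sqnorm v)%E.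
Proof.
move=> mu_ mv e0.
have e1 : 0 <= 1 + e by rewrite ltW// addr_gt0.
have e2 : 0 <= 1 + e^-1 by rewrite ltW// addr_gt0// invr_gt0.
have H0 w x : (0 <= (sqnormc (w x : R[i]))%:E)%E by rewrite lee_fin sqnormc_ge0.
have M0 w : cmeasurable w -> measurable_fun setT (fun x => (sqnormc (w x))%:E).
  exact: cmeasurable_EFin_sqnormc.
rewrite /sqnorm -!ge0_integralZl_EFin//; try by [exact: M0].
rewrite -ge0_integralD//; do ?[by move=> x _; rewrite mule_ge0 | 
  by apply: emeasurable_funM => //; exact: M0].
apply: ge0_le_integral => //.
- by move=> x _; rewrite lee_fin sqnormc_ge0.
- by apply: cmeasurable_EFin_sqnormc; exact: cmeasurableD.
- apply: emeasurable_funD;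
  by apply: emeasurable_funM => //; exact: cmeasurable_EFin_sqnormc.
by move=> x _; rewrite -!EFinM -EFinD lee_fin sqnormcD_le.
Qed.

Lemma sqnormZ (z : R[i]) u : cmeasurable u ->
  sqnorm (fun x => z * u x) = ((sqnormc z)%:E * sqnorm u)%E.
Proof.
move=> mu_; rewrite /sqnorm -ge0_integralZl_EFin//.
- by apply: eq_integral => x _; rewrite sqnormcM EFinM.
- by move=> x _; rewrite lee_fin sqnormc_ge0.
- exact: cmeasurable_EFin_sqnormc.
- exact: sqnormc_ge0.
Qed.

Lemma L2_lin (z : R[i]) u v : L2 mu u -> L2 mu v ->
  L2 mu (fun x => z * u x + v x).
Proof.
move=> /L2P[mu_ fu] /L2P[mv fv].
have mz := cmeasurableZ z mu_.
apply/L2P; split; first exact: cmeasurableD.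
apply: le_lt_trans (sqnormD_le mz mv ltr01) _.
rewrite sqnormZ//.
have /fineK <- : sqnorm u \is a fin_num by rewrite ge0_fin_numE// sqnorm_ge0.
have /fineK <- : sqnorm v \is a fin_num by rewrite ge0_fin_numE// sqnorm_ge0.
by rewrite -!EFinM -EFinD ltry.
Qed.

Lemma L2_0 : L2 mu (fun=> 0).
Proof.
apply/L2P; split; first exact: cmeasurable_cst.
by rewrite /sqnorm; under eq_integral do rewrite sqnormc0; rewrite integral0.
Qed.

Lemma L2_sum (I : Type) (s : seq I) (F : I -> T -> R[i]) (a : I -> R[i]) :
  (forall i, L2 mu (F i)) -> L2 mu (fun x => \sum_(i <- s) a i * F i x).
Proof.
move=> LF; elim: s => [|i s IH].
  by under eq_fun do rewrite big_nil; exact: L2_0.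
by under eq_fun do rewrite big_cons; exact: L2_lin.
Qed.

Lemma L2_cmeasurable u : L2 mu u -> cmeasurable u.
Proof. by move=> /L2P[]. Qed.

Lemma L2_sqnorm_fin u : L2 mu u -> sqnorm u \is a fin_num.
Proof. by move=> /L2P[_ h]; rewrite ge0_fin_numE// sqnorm_ge0. Qed.

Lemma cvg_Lpnorm2 (v_ : nat -> T -> R[i]) :
  (Lpnorm mu 2%:E (v_ n) @[n --> \oo] --> (0 : \bar R)%E) <->
  (sqnorm (v_ n) @[n --> \oo] --> (0 : \bar R)%E).
Proof.
have Q0 n := sqnorm_ge0 (v_ n); have L0 n := Lpnorm2_ge0 (v_ n).
rewrite !ge0_cvge0P//; split => h e e0.
  have : 0 < Num.sqrt e by rewrite sqrtr_gt0.
  move=> /h; apply: filterS => n /= hn.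
  have -> : e%:E = ((Num.sqrt e)%:E * (Num.sqrt e)%:E)%E.
    by rewrite -EFinM -expr2 sqr_sqrtr// ltW.
  by rewrite -Lpnorm2_sqr expe2; apply: lee_pmul.
have : 0 < e ^+ 2 by rewrite exprn_gt0.
move=> /h; apply: filterS => n /= hn.
rewrite Lpnorm2E.
have -> : e = (e ^+ 2) `^ 2^-1.
  by rewrite -powR_mulrn ?ltW// -powRrM mulfV// powRr1// ltW.
rewrite -poweR_EFin; apply: gt0_ler_poweR => //.
- by rewrite in_itv /= Q0 leey.
- by rewrite in_itv /= leey lee_fin sqr_ge0.
Qed.

End L2_basics.

(** * Passing norm equalities to the limit *)

Section isometric_limit.
Context {R : realType} {d1 d2 : measure_display}.
Context {T1 : measurableType d1} {T2 : measurableType d2}.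
Variables (mu1 : {measure set T1 -> \bar R}) (mu2 : {measure set T2 -> \bar R}).

(** Only an inequality, but the hypotheses are symmetric, so two uses give equality. The measures
    differ because one side will be L^2(mu) and the other L^2 of the spectral measure. *)
Lemma le_sqnorm_lim (w_ : nat -> T1 -> R[i]) w (h_ : nat -> T2 -> R[i]) h :
  (forall n, cmeasurable (w_ n)) -> cmeasurable w ->
  (forall n, cmeasurable (h_ n)) -> cmeasurable h ->
  (forall n, sqnorm mu1 (w_ n) = sqnorm mu2 (h_ n)) ->
  sqnorm mu1 (fun x => w_ n x - w x) @[n --> \oo] --> (0 : \bar R)%E ->
  sqnorm mu2 (fun x => h_ n x - h x) @[n --> \oo] --> (0 : \bar R)%E ->
  (sqnorm mu1 w <= sqnorm mu2 h)%E.
Proof.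
move=> mw_ mw mh_ mh wh.
move=> /ge0_cvge0P cw /ge0_cvge0P ch.
have {}cw := cw (fun n => sqnorm_ge0 _ _); have {}ch := ch (fun n => sqnorm_ge0 _ _).
have [hoo|hfin] := eqVneq (sqnorm mu2 h) +oo%E; first by rewrite hoo leey.
have hf : sqnorm mu2 h \is a fin_num by rewrite ge0_fin_numE ?sqnorm_ge0// ltey.
rewrite -(fineK hf); set B := fine _.
have B0 : 0 <= B by rewrite fine_ge0// sqnorm_ge0.
(* At an index where both errors are below dl, the weighted inequality is used twice, for w = w_n +
   (w - w_n) and for h_n = h + (h_n - h). *)
have key (e dl : R) : 0 < e -> 0 < dl ->
    (sqnorm mu1 w <= ((1 + e) * ((1 + e) * B + (1 + e^-1) * dl) +
                      (1 + e^-1) * dl)%:E)%E.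
  move=> e0 dl0.
  have [n [hn wn]] : exists n, (sqnorm mu2 (fun x => h_ n x - h x)%R <= dl%:E)%E /\
      (sqnorm mu1 (fun x => w_ n x - w x)%R <= dl%:E)%E.
    have [n _ hn] := ch _ dl0; have [m _ hm] := cw _ dl0.
    by exists (maxn n m); split; [apply: hn|apply: hm];
      rewrite /= ?leq_maxl ?leq_maxr.
  have e1 : (0 <= (1 + e)%:E)%E by rewrite lee_fin addr_ge0// ltW.
  have e2 : (0 <= (1 + e^-1)%:E)%E by rewrite lee_fin addr_ge0// invr_ge0 ltW.
  have -> : sqnorm mu1 w = sqnorm mu1 (fun x => w_ n x + (w x - w_ n x)).
    by apply: eq_sqnorm => x; rewrite addrC subrK.
  apply: le_trans (sqnormD_le _ (mw_ n) (cmeasurableB mw (mw_ n)) e0) _.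
  rewrite (EFinD ((1 + e) * _)) (EFinM (1 + e)) (EFinM (1 + e^-1) dl).
  apply: leeD; last first.
    apply: lee_pmul => //; first exact: sqnorm_ge0.
    apply: le_trans wn; rewrite le_eqVlt; apply/orP; left; apply/eqP.
    by apply: eq_integral => x _; rewrite sqnormcB_comm.
  apply: lee_pmul => //; first exact: sqnorm_ge0.
  rewrite wh.
  have -> : sqnorm mu2 (h_ n) = sqnorm mu2 (fun x => h x + (h_ n x - h x)).
    by apply: eq_sqnorm => x; rewrite addrC subrK.
  apply: le_trans (sqnormD_le _ mh (cmeasurableB (mh_ n) mh) e0) _.
  rewrite (EFinD (_ * B)) (EFinM _ B) (EFinM _ dl) /B fineK//.
  by apply: leeD => //; apply: lee_pmul => //; exact: sqnorm_ge0.
(* The terms in dl add up to (2 + e)(1 + 1/e) dl, so dl is chosen to make this eta; then (1 + e)^2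
   <= 1 + 3 e because e <= 1. *)
have key2 (e : R) : 0 < e -> e <= 1 -> (sqnorm mu1 w <= (B + 3 * e * B)%:E)%E.
  move=> e0 e1; apply/lee_addgt0Pr => eta eta0.
  have k0 : 0 < (2 + e) * (1 + e^-1).
    by rewrite mulr_gt0// addr_gt0// invr_gt0.
  apply: le_trans (key e (eta / ((2 + e) * (1 + e^-1))) e0 _) _.
    by rewrite divr_gt0.
  rewrite -EFinD lee_fin.
  have -> : (1 + e) * ((1 + e) * B + (1 + e^-1) * (eta / ((2 + e) * (1 + e^-1)))) +
    (1 + e^-1) * (eta / ((2 + e) * (1 + e^-1))) = (1 + e) ^+ 2 * B + eta.
    have ? : 1 + e^-1 != 0 by rewrite gt_eqF// addr_gt0// invr_gt0.
    have ? : 2 + e != 0 by rewrite gt_eqF// addr_gt0.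
    set g := 1 + e^-1; field; by rewrite /g; apply/andP.
  have : e * e * B <= e * B by rewrite ler_wpM2r// ler_piMl// ltW.
  rewrite expr2; lra.
apply/lee_addgt0Pr => eta eta0.
(* This e makes the excess 3 e B at most eta. If it is larger than 1, then eta > 3 B and e = 1
   serves. *)
have [H1|H1] := leP (eta / (3 * (B + 1))) 1; last first.
  apply: le_trans (key2 1 ltr01 (lexx _)) _; rewrite -EFinD lee_fin.
  by move: H1; rewrite ltr_pdivlMr ?mulr_gt0 ?ltr_wpDl//; lra.
apply: le_trans (key2 _ _ H1) _; first by rewrite divr_gt0// mulr_gt0// ltr_wpDl.
rewrite -EFinD lee_fin lerD2l.
have -> : 3 * (eta / (3 * (B + 1))) * B = eta * (B / (B + 1)).
  by field; rewrite gt_eqF// ltr_wpDl.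
apply: ler_piMr; first exact: ltW.
by rewrite ler_pdivrMr ?ltr_wpDl// mul1r lerDl.
Qed.

End isometric_limit.

(** * Completeness of L^2 for rapidly converging sequences *)

Section Riesz_Fischer.
Context {R : realType}.

(** Nested intervals: 2 K 2^-n is the sum of all increments from n on, so f n - 2 K 2^-n increases,
    f n + 2 K 2^-n decreases, and the supremum of the former is the limit. *)
Lemma geometric_cauchy_cvg (f : nat -> R) (K : R) :
  (forall n, `|f n.+1 - f n| <= K * (2^-1) ^+ n) ->
  exists l, f n @[n --> \oo] --> l /\
    forall n, `|f n - l| <= 2 * K * (2^-1) ^+ n.
Proof.
move=> fK.
pose a n := f n - 2 * K * (2^-1) ^+ n; pose b n := f n + 2 * K * (2^-1) ^+ n.
have K0 : 0 <= K by have := fK 0%N; rewrite expr0 mulr1; apply: le_trans.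
have ab n : a n <= b n.
  have : 0 <= 2 * K * (2^-1) ^+ n by rewrite !mulr_ge0// exprn_ge0// invr_ge0.
  rewrite /a /b; lra.
have ha : nondecreasing_seq a.
  apply/nondecreasing_seqP => n; move: (fK n); rewrite /a exprS ler_norml => /andP[].
  lra.
have hb : nonincreasing_seq b.
  apply/nonincreasing_seqP => n; move: (fK n); rewrite /b exprS ler_norml => /andP[].
  lra.
have abn n m : a n <= b m.
  have := ha n (maxn n m) (leq_maxl _ _); have := hb m (maxn n m) (leq_maxr _ _).
  have := ab (maxn n m); lra.
pose l := sup (range a).
have hl n : `|f n - l| <= 2 * K * (2^-1) ^+ n.
  have h1 : a n <= l.
    apply: ub_le_sup; last by exists n.
    by exists (b 0%N) => _ [m _ <-].
  have h2 : l <= b n.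
    apply: ge_sup; first by exists (a 0%N), 0%N.
    by move=> _ [m _ <-].
  by move: h1 h2; rewrite ler_norml /a /b; lra.
exists l; split => //.
have c0 : 2 * K * (2^-1) ^+ n @[n --> \oo] --> (0 : R).
  rewrite -[X in _ --> X](mulr0 (2 * K)); apply: cvgMr.
  by apply: cvg_expr; rewrite ger0_norm ?invr_ge0// invf_lt1// ltr1n.
have : f n - l @[n --> \oo] --> (0 : R).
  apply/cvgr0Pnorm_le => e e0; move/cvgr0Pnorm_le: c0 => /(_ e e0).
  apply: filterS => n hn; apply: le_trans (hl n) _.
  exact: le_trans (ler_norm _) hn.
by move=> /cvg_sub0 h; apply: h; exact: cvg_cst.
Qed.

End Riesz_Fischer.
Section Riesz_Fischer.
Context {R : realType}.
Context {d : measure_display} {T : measurableType d}.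
Variable mu : {measure set T -> \bar R}.

(* The geometric rate gives |f n.+1 - f n| <= sqrt H * 2^-n for the integrable
   function H = \sum_n 4^n |f n.+1 - f n|^2, hence a limit at almost every
   point. *)
Lemma Riesz_Fischer_real (f : nat -> T -> R) (C : R) :
  (forall n, measurable_fun setT (f n)) ->
  (forall n, \int[mu]_x ((f n.+1 x - f n x) ^+ 2)%:E <= (C * (8^-1) ^+ n)%:E)%E ->
  exists g : T -> R, measurable_fun setT g /\
    (\int[mu]_x ((f n x - g x) ^+ 2)%:E)%E @[n --> \oo] --> (0 : \bar R)%E.
Proof.
move=> mf fC.
have C0 : 0 <= C.
  have := fC 0%N; rewrite expr0 mulr1 -lee_fin; apply: le_trans.
  apply: integral_ge0 => x _. by rewrite lee_fin; exact: sqr_ge0.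
pose D n x : \bar R := ((4 ^+ n * (f n.+1 x - f n x) ^+ 2)%:E)%E.
have D0 n x : (0 <= D n x)%E by rewrite lee_fin mulr_ge0 ?sqr_ge0 ?exprn_ge0.
have mD n : measurable_fun setT (D n).
  apply/measurable_EFinP; apply: measurable_funM => //.
  by apply: measurable_funX; apply: measurable_funB.
pose H x := (\sum_(0 <= n <oo) D n x)%E.
have mH : measurable_fun setT H.
  by apply: ge0_emeasurable_sum => // n x _ _; exact: D0.
have H0 x : (0 <= H x)%E by apply: nneseries_ge0 => n _ _; exact: D0.
have iH : (\int[mu]_x H x <= (2 * C)%:E)%E.
  rewrite integral_nneseries//.
  apply: lime_le.
    by apply: is_cvg_nneseries => n _ _; apply: integral_ge0 => x _; exact: D0.
  near=> n.
  (* The weight 4^k against the rate 8^-k leaves 2^-k, and these sum to at most 2. *)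
  apply: (@le_trans _ _ (\sum_(0 <= k < n) (C * (2^-1) ^+ k)%:E)%E).
    apply: lee_sum => k _; rewrite /D; under eq_integral do rewrite EFinM.
    have p4 : 0 <= (4 : R) ^+ k by rewrite exprn_ge0.
    have mk : measurable_fun setT (fun x => ((f k.+1 x - f k x) ^+ 2)%:E).
      by apply/measurable_EFinP; apply: measurable_funX; apply: measurable_funB.
    rewrite ge0_integralZl_EFin//; last by move=> x _; rewrite lee_fin; exact: sqr_ge0.
    apply: le_trans (lee_wpmul2l _ (fC k)) _; first by rewrite lee_fin.
    rewrite -EFinM lee_fin mulrCA -exprMn.
    by rewrite (_ : 4 * 8^-1 = 2^-1 :> R)//; field.
  rewrite sumEFin lee_fin -mulr_sumr mulrC ler_wpM2r//.
  elim: (n) => [|k IH]; first by rewrite big_nil.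
  have : \sum_(0 <= k0 < k) (2^-1 : R) ^+ k0 <= 2 - 2 * 2^-1 ^+ k.
    elim: (k) => [|j IHj]; first by rewrite big_nil expr0 mulr1 subrr.
    by rewrite big_nat_recr//= exprS; lra.
  rewrite big_nat_recr//=; have : 0 <= (2^-1 : R) ^+ k by rewrite exprn_ge0.
  lra.
pose G := [set x | (H x < +oo)%E].
have mG : measurable G.
  by rewrite -[G]setTI; apply: emeasurable_fun_infty_o.
have aeG : {ae mu, forall x, G x}.
  have iHf : mu.-integrable setT H.
    apply/integrableP; split => //.
    under eq_integral do rewrite gee0_abs//.
    exact: le_lt_trans iH (ltry _).
  have := integrable_ae measurableT iHf.
  by apply: filterS => x /(_ I); rewrite ge0_fin_numE.
have HG x n : G x -> `|f n.+1 x - f n x| <= Num.sqrt (fine (H x)) * (2^-1) ^+ n.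
  move=> Gx.
  have Hx : H x \is a fin_num by rewrite ge0_fin_numE.
  have : (D n x <= H x)%E.
    have h : (\sum_(0 <= k < n.+1) D k x <= H x)%E.
      by apply: nneseries_lim_ge => k _ _; exact: D0.
    apply: le_trans h; rewrite big_nat_recr//=.
    by rewrite leeDr// sume_ge0.
  rewrite -(fineK Hx) /D lee_fin => h.
  have h2 : (f n.+1 x - f n x) ^+ 2 <= fine (H x) * ((2^-1) ^+ n) ^+ 2.
    rewrite -exprM mulnC exprM -ler_pdivrMr; last by rewrite exprn_gt0// exprn_gt0// invr_gt0.
    apply: le_trans h; rewrite mulrC; apply: ler_wpM2r; first exact: sqr_ge0.
    by rewrite -exprVn (_ : _^-1 = 4)//; field.
  have := ler_wsqrtr h2; rewrite sqrtr_sqr sqrtrM ?fine_ge0// sqrtr_sqr.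
  by rewrite (ger0_norm (exprn_ge0 _ _))// invr_ge0.
(* Cutting off outside G makes the sequence converge at every point, so its limit g is
   measurable. *)
have fG n : measurable_fun setT (fun x => f n x * \1_G x).
  by apply: measurable_funM => //; exact: measurable_indic.
have /choice[g gP] : forall x, exists l, (f n x * \1_G x) @[n --> \oo] --> l /\
    (G x -> forall n, `|f n x - l| <= 2 * Num.sqrt (fine (H x)) * (2^-1) ^+ n).
  move=> x; have [Gx|Gx] := pselect (G x).
    have [l [cl hl]] := geometric_cauchy_cvg (fun n => HG x n Gx).
    by exists l; split => //; rewrite indicE mem_set//; under eq_fun do rewrite mulr1.
  exists 0; split => //; rewrite indicE memNset//.
  by under eq_fun do rewrite mulr0; exact: cvg_cst.
have mg : measurable_fun setT g.
  by apply: (measurable_fun_cvg fG) => x _; have [] := gP x.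
exists g; split => //.
apply/ge0_cvge0P.
  by move=> n; apply: integral_ge0 => x _; rewrite lee_fin; exact: sqr_ge0.
have fgC n : (\int[mu]_x ((f n x - g x) ^+ 2)%:E <= (8 * C * (2^-1) ^+ n)%:E)%E.
  (* On G, |f n - g|^2 <= (2 sqrt(H) 2^-n)^2 = 4 H 4^-n, and the weaker 2^-n suffices; off G the
     right side is +oo. *)
  apply: (@le_trans _ _ (\int[mu]_x ((4 * (2^-1) ^+ n)%:E * H x))%E).
    apply: ge0_le_integral => //.
    - by move=> x _; rewrite lee_fin; exact: sqr_ge0.
    - by apply/measurable_EFinP; apply: measurable_funX; apply: measurable_funB.
    - by apply: emeasurable_funM.
    move=> x _; have [Gx|] := pselect (G x); last first.
      rewrite /G /= => /negP; rewrite -leNgt leye_eq => /eqP ->.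
      by rewrite gt0_muley ?leey// lte_fin mulr_gt0// exprn_gt0// invr_gt0.
    have Hx : H x \is a fin_num by rewrite ge0_fin_numE.
    rewrite -(fineK Hx) -EFinM lee_fin.
    have := (gP x).2 Gx n.
    move=> /(lerXn2r 2) => h; have {h} := h _ _.
    rewrite !nnegrE !mulr_ge0 ?sqrtr_ge0 ?exprn_ge0 ?invr_ge0// => /(_ (normr_ge0 _) isT).
    rewrite /= real_normK ?num_real// => h; apply: le_trans h _.
    rewrite !exprMn sqr_sqrtr ?fine_ge0//.
    have h1 : ((2^-1 : R) ^+ n) ^+ 2 <= (2^-1) ^+ n.
      by rewrite expr2 ler_piMr ?exprn_ge0 ?exprn_ile1// ?invr_ge0// invf_le1// ler1n.
    have -> : (2 : R) ^+ 2 = 4 by rewrite -natrX.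
    rewrite -mulrA -[leRHS]mulrA ler_wpM2l// mulrC ler_wpM2r// fine_ge0//.
  rewrite ge0_integralZl_EFin// ?mulr_ge0 ?exprn_ge0//.
  apply: le_trans (lee_wpmul2l _ iH) _.
    by rewrite lee_fin mulr_ge0 ?exprn_ge0.
  by rewrite -EFinM lee_fin; lra.
move=> e e0.
have : 8 * C * (2^-1) ^+ n @[n --> \oo] --> (0 : R).
  rewrite -[X in _ --> X](mulr0 (8 * C)); apply: cvgMr.
  by apply: cvg_expr; rewrite ger0_norm ?invr_ge0// invf_lt1// ltr1n.
move=> /cvgr0Pnorm_le /(_ e e0); apply: filterS => n hn.
apply: le_trans (fgC n) _; rewrite lee_fin.
exact: le_trans (ler_norm _) hn.
Unshelve. all: by end_near. Qed.

End Riesz_Fischer.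

(** * The inner product of L^2 *)

Section inner_product.
Context {R : realType} {d : measure_display} {T : measurableType d}.
Variable mu : {measure set T -> \bar R}.
Implicit Types u v w : T -> R[i].

(** The real case is applied to real and imaginary parts. The rate 8^-n costs nothing, since
    approximating sequences can be chosen that fast. *)
Lemma Riesz_Fischer (f : nat -> T -> R[i]) (C : R) :
  (forall n, L2 mu (f n)) ->
  (forall n, sqnorm mu (fun x => f n.+1 x - f n x)%R <= (C * (8^-1) ^+ n)%:E)%E ->
  exists2 g : T -> R[i], L2 mu g &
    sqnorm mu (fun x => f n x - g x) @[n --> \oo] --> (0 : \bar R)%E.
Proof.
move=> Lf fC.
have mf n := L2_cmeasurable (Lf n).
have mD n : measurable_fun setT (fun x => (sqnormc (f n.+1 x - f n x))%:E).
  by apply: cmeasurable_EFin_sqnormc; exact: cmeasurableB.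
have [g1 [mg1 hg1]] : exists g : T -> R, measurable_fun setT g /\
    (\int[mu]_x ((complex.Re (f n x) - g x) ^+ 2)%:E)%E @[n --> \oo] --> (0 : \bar R)%E.
  apply: (@Riesz_Fischer_real _ _ _ mu (fun n x => complex.Re (f n x)) C) => n.
    exact: (mf n).1.
  apply: le_trans (fC n); apply: ge0_le_integral => //.
  - by move=> x _; rewrite lee_fin; exact: sqr_ge0.
  - apply/measurable_EFinP; apply: measurable_funX; apply: measurable_funB.
      exact: (mf _).1.
    exact: (mf _).1.
  by move=> x _; rewrite lee_fin /sqnormc !RIE lerDl; exact: sqr_ge0.
have [g2 [mg2 hg2]] : exists g : T -> R, measurable_fun setT g /\
    (\int[mu]_x ((complex.Im (f n x) - g x) ^+ 2)%:E)%E @[n --> \oo] --> (0 : \bar R)%E.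
  apply: (@Riesz_Fischer_real _ _ _ mu (fun n x => complex.Im (f n x)) C) => n.
    exact: (mf n).2.
  apply: le_trans (fC n); apply: ge0_le_integral => //.
  - by move=> x _; rewrite lee_fin; exact: sqr_ge0.
  - apply/measurable_EFinP; apply: measurable_funX; apply: measurable_funB.
      exact: (mf _).2.
    exact: (mf _).2.
  by move=> x _; rewrite lee_fin /sqnormc !RIE lerDr; exact: sqr_ge0.
pose g x : R[i] := Complex (g1 x) (g2 x).
have mg : cmeasurable g by split.
have cg : sqnorm mu (fun x => f n x - g x) @[n --> \oo] --> (0 : \bar R)%E.
  have := cvgeD _ hg1 hg2; rewrite adde0 => /(_ _ isT).
  apply: cvg_trans; apply: near_eq_cvg; apply: nearW => n.
  rewrite /sqnorm -ge0_integralD//.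
  - by apply: eq_integral => x _; rewrite -EFinD /sqnormc !RIE.
  - by move=> x _; rewrite lee_fin; exact: sqr_ge0.
  - apply/measurable_EFinP; apply: measurable_funX; apply: measurable_funB => //.
    exact: (mf _).1.
  - by move=> x _; rewrite lee_fin; exact: sqr_ge0.
  - apply/measurable_EFinP; apply: measurable_funX; apply: measurable_funB => //.
    exact: (mf _).2.
exists g => //; apply/L2P; split => //.
move/ge0_cvge0P : cg => /(_ (fun n => sqnorm_ge0 _ _) 1 ltr01)[n _ hn].
have -> : sqnorm mu g = sqnorm mu (fun x => f n x + - (f n x - g x)).
  by apply: eq_sqnorm => x; rewrite opprB addrC subrK.
apply: le_lt_trans (sqnormD_le _ (mf n) (cmeasurableN (cmeasurableB (mf n) mg)) ltr01) _.
have -> : sqnorm mu (fun x => - (f n x - g x)) = sqnorm mu (fun x => f n x - g x).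
  by apply: eq_integral => x _; rewrite sqnormcN.
rewrite -(fineK (L2_sqnorm_fin (Lf n))) -EFinM.
apply: le_lt_trans (leeD2l _ (lee_wpmul2l _ (hn n (leqnn n)))) _.
  by rewrite lee_fin.
by rewrite -EFinM -EFinD ltry.
Qed.

(** Dominated by |u|^2 + |v|^2, through |p q| <= (p^2 + q^2) / 2 in place of the Cauchy-Schwarz
    inequality. *)
Lemma L2_Re_integrable u v : L2 mu u -> L2 mu v ->
  mu.-integrable setT (fun x => (complex.Re (u x * (v x)^*%C))%:E).
Proof.
move=> /L2P[mu_ fu] /L2P[mv fv].
apply: (@le_integrable _ _ _ mu setT _ _
   (fun x => ((sqnormc (u x))%:E + (sqnormc (v x))%:E)%E)) => //.
- have [a b] := mu_; have [a' b'] := mv.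
  apply/measurable_EFinP.
  have -> : (fun x => complex.Re (u x * (v x)^*%C)) = (fun x =>
      complex.Re (u x) * complex.Re (v x) + complex.Im (u x) * complex.Im (v x)).
    by apply/funext => x; case: (u x) (v x) => ? ? [? ?]/=; rewrite mulrN opprK.
  by apply: measurable_funD; apply: measurable_funM.
- move=> x _; rewrite -EFinD !abse_EFin lee_fin (ger0_norm (addr_ge0 _ _)) ?sqnormc_ge0//.
  case: (u x) (v x) => a b [a' b']; rewrite /sqnormc /= mulrN opprK.
  have h (p q : R) : `|p * q| <= (p ^+ 2 + q ^+ 2) / 2.
    have := sqr_ge0 (p - q); have := sqr_ge0 (p + q).
    by rewrite ler_norml => ? ?; apply/andP; split; lra.
  have := h a a'; have := h b b'; rewrite /= => *.
  apply: le_trans (ler_normD _ _) _.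
  have := sqr_ge0 a; have := sqr_ge0 b; have := sqr_ge0 a'; have := sqr_ge0 b'.
  lra.
have h w : cmeasurable w -> (sqnorm mu w < +oo)%E ->
    mu.-integrable setT (fun x => (sqnormc (w x))%:E).
  move=> mw fw; apply/integrableP; split; first exact: cmeasurable_EFin_sqnormc.
  by under eq_integral do rewrite gee0_abs ?lee_fin ?sqnormc_ge0//.
by apply: integrableD => //; exact: h.
Qed.

Lemma L2Z (z : R[i]) u : L2 mu u -> L2 mu (fun x => z * u x).
Proof.
by move=> Lu; have := L2_lin z Lu (L2_0 mu); under eq_fun do rewrite addr0.
Qed.

(** Im z = Re (- i z), so this is the previous case for - i u. *)
Lemma L2_Im_integrable u v : L2 mu u -> L2 mu v ->
  mu.-integrable setT (fun x => (complex.Im (u x * (v x)^*%C))%:E).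
Proof.
move=> Lu Lv; have := L2_Re_integrable (L2Z (- 'i%C) Lu) Lv.
congr (integrable _ _ _); apply/funext => x; congr EFin.
by case: (u x) (v x) => ? ? [? ?]/=; ring.
Qed.

Lemma inner_conj u v : L2 mu u -> L2 mu v -> inner mu v u = (inner mu u v)^*%C.
Proof.
move=> Lu Lv; rewrite /inner /=; congr Complex.
  by apply: eq_Rintegral => x _; case: (u x) (v x) => ? ? [? ?]/=; ring.
rewrite -mulN1r -RintegralZl//; last exact: L2_Im_integrable.
by apply: eq_Rintegral => x _; case: (u x) (v x) => ? ? [? ?]/=; ring.
Qed.

Lemma inner_linl (a : R[i]) u v w : L2 mu u -> L2 mu v -> L2 mu w ->
  inner mu (fun x => a * u x + v x) w = a * inner mu u w + inner mu v w.
Proof.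
move=> Lu Lv Lw.
have RI u' : L2 mu u' -> mu.-integrable setT (EFin \o (fun x => complex.Re (u' x * (w x)^*%C))).
  by move=> Lu'; exact: L2_Re_integrable.
have II u' : L2 mu u' -> mu.-integrable setT (EFin \o (fun x => complex.Im (u' x * (w x)^*%C))).
  by move=> Lu'; exact: L2_Im_integrable.
have lin3 (p q : R) (f1 f2 f3 : T -> R) : mu.-integrable setT (EFin \o f1) ->
    mu.-integrable setT (EFin \o f2) -> mu.-integrable setT (EFin \o f3) ->
    \int[mu]_x (p * f1 x + q * f2 x + f3 x) =
    p * \int[mu]_x f1 x + q * \int[mu]_x f2 x + \int[mu]_x f3 x.
  move=> i1 i2 i3.
  have iZ (k : R) f : mu.-integrable setT (EFin \o f) ->
      mu.-integrable setT (EFin \o (fun x => k * f x)).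
    move=> h; apply: (eq_integrable measurableT (fun x => k%:E * (EFin \o f) x)%E) => //.
    exact: integrableZl.
  rewrite RintegralD//; last exact: (integrableD measurableT (iZ p f1 i1) (iZ q f2 i2)).
  by rewrite RintegralD ?RintegralZl//; exact: iZ.
rewrite /inner; case: a => p q; apply/eqP; rewrite eq_complex /=; apply/andP.
have [Ru Iu] := (RI u Lu, II u Lu); have [Rv Iv] := (RI v Lv, II v Lv).
split; apply/eqP.
  rewrite -mulNr -lin3//; apply: eq_Rintegral => x _.
  by case: (u x) (v x) (w x) => ? ? [? ?] [? ?] /=; ring.
rewrite -lin3//; apply: eq_Rintegral => x _.
by case: (u x) (v x) (w x) => ? ? [? ?] [? ?] /=; ring.
Qed.

Lemma inner_suml (I : Type) (s : seq I) (a : I -> R[i]) (F : I -> T -> R[i]) w :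
  (forall i, L2 mu (F i)) -> L2 mu w ->
  inner mu (fun x => \sum_(i <- s) a i * F i x) w =
  \sum_(i <- s) a i * inner mu (F i) w.
Proof.
move=> LF Lw; elim: s => [|i s IH].
  rewrite big_nil; under eq_fun do rewrite big_nil.
  have := inner_linl (-1) (L2_0 mu) (L2_0 mu) Lw.
  have -> : (fun x : T => -1 * 0 + 0) = (fun=> 0 : R[i]) by apply/funext => x; rewrite mulr0 addr0.
  by rewrite [X in _ = X -> _](_ : _ = 0) ?mulN1r ?addNr.
rewrite big_cons -IH -inner_linl//; last exact: L2_sum.
by congr inner; apply/funext => x; rewrite big_cons.
Qed.

Lemma inner_sum (I J : Type) (s : seq I) (r : seq J) (a : I -> R[i]) (b : J -> R[i])
    (F : I -> T -> R[i]) (G : J -> T -> R[i]) :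
  (forall i, L2 mu (F i)) -> (forall j, L2 mu (G j)) ->
  inner mu (fun x => \sum_(i <- s) a i * F i x) (fun x => \sum_(j <- r) b j * G j x) =
  \sum_(i <- s) \sum_(j <- r) a i * (b j)^*%C * inner mu (F i) (G j).
Proof.
move=> LF LG; rewrite inner_suml//; last exact: L2_sum.
apply: eq_bigr => i _; rewrite inner_conj//; last exact: L2_sum.
rewrite inner_suml// rmorph_sum mulr_sumr; apply: eq_bigr => j _.
by rewrite rmorphM mulrA (inner_conj (LG j) (LF i)).
Qed.

Lemma inner_self u : L2 mu u -> inner mu u u = (fine (sqnorm mu u))%:C%C.
Proof.
move=> Lu; apply/eqP; rewrite eq_complex /=; apply/andP; split; apply/eqP.
  rewrite /Rintegral; congr fine; apply: eq_integral => x _; congr EFin.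
  by rewrite /sqnormc; case: (u x) => ? ? /=; ring.
rewrite (@eq_Rintegral _ _ _ mu setT (fun=> 0)) ?Rintegral_cst ?mul0r//.
by move=> x _; case: (u x) => ? ? /=; ring.
Qed.

Lemma ae_eq_innerl u u' v : L2 mu u -> L2 mu u' -> L2 mu v ->
  u = u' %[ae mu] -> inner mu u v = inner mu u' v.
Proof.
move=> Lu Lu' Lv uu'; rewrite /inner /Rintegral; congr Complex; congr fine.
  apply: ae_eq_integral => //.
  - by have /integrableP[] := L2_Re_integrable Lu Lv.
  - by have /integrableP[] := L2_Re_integrable Lu' Lv.
  by apply: filterS uu' => x /= h /h ->.
apply: ae_eq_integral => //.
- by have /integrableP[] := L2_Im_integrable Lu Lv.
- by have /integrableP[] := L2_Im_integrable Lu' Lv.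
by apply: filterS uu' => x /= h /h ->.
Qed.

(** Used with a = -1 for sigma-additivity of the spectral mass, and with a = M to exclude negative
    spectrum. *)
Lemma sqnorm_lin (a : R[i]) u v : L2 mu u -> L2 mu v ->
  fine (sqnorm mu (fun x => a * u x + v x)) =
  sqnormc a * fine (sqnorm mu u) + 2 * complex.Re (a * inner mu u v) +
  fine (sqnorm mu v).
Proof.
move=> Lu Lv; have Lw := L2_lin a Lu Lv.
have := inner_self Lw; rewrite inner_linl//.
rewrite (inner_conj Lw Lu) (inner_conj Lw Lv) !inner_linl//.
rewrite (inner_conj Lu Lv) !inner_self//.
case: (inner mu u v) => p q; case: a {Lw} => a b /= [+ _] => <-.
by rewrite /sqnormc /=; ring.
Qed.

End inner_product.

(** * The spectral mass is a measure *)

Section spectral_mass_measure.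
Context {R : realType} {d : measure_display} {T : measurableType d}.
Variable mu : {measure set T -> \bar R}.
Variables (E : set R -> (T -> R[i]) -> (T -> R[i])) (u : T -> R[i]).
Hypotheses (pE : is_pvm mu E) (Lu : L2 mu u).
Implicit Types B : set R.

Let g B : R := fine (sqnorm mu (E B u)).

Let LE B : measurable B -> L2 mu (E B u).
Proof. by move=> mB; exact: (pvm_L2 pE). Qed.

Lemma spectral_massE B : spectral_mass mu E u B = sqnorm mu (E B u).
Proof. by rewrite /spectral_mass Lpnorm2_sqr. Qed.

(** Symmetry and multiplicativity give <E(B)u, E(B')u> = <E(B [&] B')u, u>; the same identity for
    the pair (B [&] B', B [&] B') turns this into a squared norm. Disjoint sets thus give orthogonal
    vectors. *)
Lemma pvm_inner B B' : measurable B -> measurable B' ->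
  inner mu (E B u) (E B' u) = (fine (sqnorm mu (E (B `&` B') u)))%:C%C.
Proof.
have h C C' : measurable C -> measurable C' ->
    inner mu (E C u) (E C' u) = inner mu (E (C `&` C') u) u.
  move=> mC mC'; rewrite -(pvm_sym pE)//; last exact: LE.
  rewrite setIC; apply: ae_eq_innerl => //.
  - by apply: (pvm_L2 pE) => //; exact: LE.
  - by apply: LE; exact: measurableI.
  by apply: filterS (pvm_setI pE mC' mC Lu) => x /= /[apply] ->.
move=> mB mB'; have mI := measurableI _ _ mB mB'.
rewrite h// -[in LHS](setIid (B `&` B')) -h// inner_self//; exact: LE.
Qed.

(** Sigma-additivity for the constant sequence [set0] says that (n - 1) E(set0)u tends to 0. *)
Lemma sqnorm_pvm0 : sqnorm mu (E set0 u) = 0%E.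
Proof.
have L0 := LE measurable0.
have t0 : trivIset setT (fun _ : nat => set0 : set R) by move=> i j _ _ [x []].
have := pvm_sigma_additive pE (fun n : nat => measurable0) t0 Lu.
rewrite bigcup0//.
move=> /cvg_Lpnorm2/ge0_cvge0P => /(_ (fun n => sqnorm_ge0 _ _)) h.
apply/eqP; rewrite eq_le sqnorm_ge0 andbT; apply/lee_addgt0Pr => e e0.
have [n _ hn] := h _ e0; rewrite add0e.
(* With n.+2 terms, n.+1 copies of E(set0)u survive the subtraction, hence at least one. *)
apply: le_trans (hn (n.+2) _); last by rewrite /= leqW.
apply: ge0_le_integral => //.
- by move=> x _; rewrite lee_fin sqnormc_ge0.
- exact: cmeasurable_EFin_sqnormc (L2_cmeasurable L0).
- apply: cmeasurable_EFin_sqnormc.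
  under eq_fun do rewrite sumr_const card_ord -mulr_natl -[X in _ - X]mul1r -mulrBl.
  exact: cmeasurableZ (L2_cmeasurable L0).
move=> x _; rewrite lee_fin sumr_const card_ord mulrS addrAC subrr add0r.
rewrite -mulr_natl sqnormcM ler_peMl ?sqnormc_ge0// /sqnormc.
have -> : n.+1%:R = (n.+1%:R : R)%:C%C by rewrite rmorph_nat.
by rewrite /= expr0n addr0 -natrX ler1n expn_gt0.
Qed.

Lemma spectral_mass0 : spectral_mass mu E u set0 = 0%E.
Proof. by rewrite spectral_massE sqnorm_pvm0. Qed.

Lemma spectral_mass_ge0 B : (0 <= spectral_mass mu E u B)%E.
Proof. by rewrite spectral_massE sqnorm_ge0. Qed.

(** By orthogonality the squared distance from E(\bigcup F)u to the n-th partial sum is exactly the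
    mass of the union minus the n-th sum of masses; strong additivity sends it to 0. *)
Lemma spectral_mass_sigma_additive : semi_sigma_additive (spectral_mass mu E u).
Proof.
move=> F mF tF mUF.
have L n : L2 mu (E (F n) u) by exact: LE.
have LU := LE mUF.
pose W n x := \sum_(i < n) 1 * E (F (i : 'I_n)) u x.
have LW n : L2 mu (W n) by exact: L2_sum.
have inW n B : measurable B ->
    inner mu (W n) (E B u) = (\sum_(i < n) g (F i `&` B))%:C%C.
  move=> mB; rewrite inner_suml//; last exact: LE.
  by rewrite rmorph_sum; apply: eq_bigr => i _; rewrite mul1r pvm_inner.
have gU n : fine (sqnorm mu (fun x => -1 * E (\bigcup_i F i) u x + W n x)) =
    g (\bigcup_i F i) - \sum_(i < n) g (F i).
  rewrite sqnorm_lin// (inner_conj (LW n) LU) inW//.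
  have -> : \sum_(i < n) g (F i `&` \bigcup_i F i) = \sum_(i < n) g (F i).
    by apply: eq_bigr => i _; rewrite setIidl//; exact: bigcup_sup.
  have -> : fine (sqnorm mu (W n)) = \sum_(i < n) g (F i).
    have := inner_self (LW n).
    rewrite {1}/W inner_suml// => h.
    have -> : fine (sqnorm mu (W n)) = complex.Re ((fine (sqnorm mu (W n)))%:C%C : R[i]) by [].
    rewrite -h.
    rewrite (_ : \sum_(i < n) g (F i) = complex.Re ((\sum_(i < n) g (F i))%:C%C : R[i]))//.
    congr complex.Re; rewrite rmorph_sum; apply: eq_bigr => i _.
    rewrite mul1r (inner_conj (LW n) (L i)) inW// conjc_real; congr real_complex_def.
    rewrite (bigD1 i)//= setIid big1 ?addr0// => j ji.
    have /trivIsetP := tF => /(_ j i I I); rewrite (_ : (j != i :> nat) = true)//.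
    by move=> /(_ isT) ->; rewrite /g sqnorm_pvm0.
  by rewrite /sqnormc /= /g; ring.
have cv : g (\bigcup_i F i) - \sum_(i < n) g (F i) @[n --> \oo] --> (0 : R).
  have := pvm_sigma_additive pE mF tF Lu.
  move=> /cvg_Lpnorm2 h.
  have {h}/fine_cvgP[_] := h; apply: cvg_trans; apply: near_eq_cvg; apply: nearW => n.
  rewrite /= -gU; congr fine; apply: eq_sqnorm => x.
  have <- : W n x = \sum_(i < n) E (F i) u x by apply: eq_bigr => i _; rewrite mul1r.
  by ring.
have -> : (fun n => (\sum_(0 <= i < n) spectral_mass mu E u (F i))%E) =
    (fun n => (g (\bigcup_i F i) - (g (\bigcup_i F i) - \sum_(i < n) g (F i)))%:E).
  apply/funext => n; rewrite subKr -sumEFin big_mkord; apply: eq_bigr => i _.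
  by rewrite spectral_massE fineK//; exact: L2_sqnorm_fin.
have -> : spectral_mass mu E u (\bigcup_n F n) = (g (\bigcup_i F i) - 0)%:E.
  by rewrite subr0 spectral_massE fineK//; exact: L2_sqnorm_fin.
apply: cvg_EFin; first exact: nearW.
by apply: cvgB => //; exact: cvg_cst.
Qed.

End spectral_mass_measure.

(** A copy of [spectral_mass] that takes the two proofs as arguments, so that a measure structure
    can be attached to it. *)
Definition spectral_measure {R : realType} {d : measure_display}
  {T : measurableType d} (mu : {measure set T -> \bar R})
  (E : set R -> (T -> R[i]) -> (T -> R[i])) (u : T -> R[i])
  of is_pvm mu E & L2 mu u : set R -> \bar R := spectral_mass mu E u.

HB.instance Definition _ {R : realType} {d : measure_display}
  {T : measurableType d} (mu : {measure set T -> \bar R})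
  (E : set R -> (T -> R[i]) -> (T -> R[i])) (u : T -> R[i])
  (pE : is_pvm mu E) (Lu : L2 mu u) :=
  isMeasure.Build _ R R (spectral_measure pE Lu)
    (spectral_mass0 pE Lu) (spectral_mass_ge0 mu E u)
    (spectral_mass_sigma_additive pE Lu).

(** * Uniform approximation by simple functions *)

Section simple_functions.
Context {R : realType}.
Implicit Types (l : seq (R[i] * set R)) (z : R[i]).

(** With concatenation as addition, this encodes linear combinations of simple functions as lists
    again. *)
Definition scale_simple z l := [seq (z * q.1, q.2) | q <- l].

Lemma simple_fct_cat l l' t :
  simple_fct (l ++ l') t = simple_fct l t + simple_fct l' t.
Proof. by rewrite /simple_fct big_cat. Qed.

Lemma simple_fct_scale z l t :
  simple_fct (scale_simple z l) t = z * simple_fct l t.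
Proof.
rewrite /simple_fct big_map mulr_sumr.
by apply: eq_bigr => q _; rewrite /= mulrA.
Qed.

Lemma simple_fct_cons z (B : set R) l t :
  simple_fct ((z, B) :: l) t = z * (\1_B t)%:C%C + simple_fct l t.
Proof. by rewrite /simple_fct big_cons. Qed.

Definition measurable_simple l := forall q, q \in l -> measurable q.2.

Lemma measurable_simple_cat l l' : measurable_simple l ->
  measurable_simple l' -> measurable_simple (l ++ l').
Proof. by move=> h h' q; rewrite mem_cat => /orP[/h|/h']. Qed.

Lemma measurable_simple_scale z l : measurable_simple l ->
  measurable_simple (scale_simple z l).
Proof. by move=> h q /mapP[r /h hr ->]. Qed.

Lemma measurable_simple_cons z (B : set R) l : measurable B ->
  measurable_simple l -> measurable_simple ((z, B) :: l).
Proof. by move=> mB h q; rewrite inE => /orP[/eqP ->//|/h]. Qed.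

(* Binary digits: peel off the set where [K / 2 <= f]. *)
Lemma simple_approx_ge0 (n : nat) (f : R -> R) (K : R) :
  measurable_fun setT f -> (forall t, 0 <= f t <= K) ->
  exists l, measurable_simple l /\ forall t, exists r : R,
    simple_fct l t = r%:C%C /\ 0 <= f t - r <= K * (2^-1) ^+ n.
Proof.
elim: n f K => [|n IH] f K mf fK.
  exists [::]; split=> // t; exists 0; split.
    by rewrite /simple_fct big_nil.
  by rewrite subr0 expr0 mulr1.
pose B := [set t | K / 2 <= f t].
have mB : measurable B.
  rewrite -[B]setTI; have := mf measurableT `[K / 2, +oo[%classic.
  rewrite preimage_itvcy => h; apply: h; exact: measurable_itv.
have [] := IH (fun t => f t - K / 2 * \1_B t) (K / 2).
- apply: measurable_funB => //; apply: measurable_funM => //.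
- move=> t; have := fK t; rewrite indicE.
  have [tB|tB] := boolP (t \in B); rewrite /= ?mulr1 ?mulr0.
    by move: tB; rewrite inE /B /=; lra.
  by move: tB; rewrite notin_setE /B /= => /negP; rewrite -ltNge; lra.
move=> l [ml hl]; exists (((K / 2)%:C%C, B) :: l); split.
  exact: measurable_simple_cons.
move=> t; have [r [hr rK]] := hl t; exists (K / 2 * \1_B t + r); split.
  by rewrite simple_fct_cons hr -rmorphM -rmorphD.
by rewrite opprD addrA exprS mulrA.
Qed.

(** Adding K to both parts brings them into [0, 2 K], where the binary approximation applies. *)
Lemma simple_approx (f : R -> R[i]) (K e : R) : cmeasurable f ->
  (forall t, `|complex.Re (f t)| <= K) -> (forall t, `|complex.Im (f t)| <= K) ->
  0 < e ->
  exists l, measurable_simple l /\ forall t, sqnormc (simple_fct l t - f t) <= e.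
Proof.
move=> [mRe mIm] fRe fIm e0.
have K0 : 0 <= K by apply: le_trans (fRe 0).
have [n hn] : exists n, 2 * (2 * K * (2^-1) ^+ n) ^+ 2 <= e.
  have : 2 * ((2 * K * (2^-1) ^+ n) * (2 * K * (2^-1) ^+ n)) @[n --> \oo] --> (2 * ((2 * K * 0) * (2 * K * 0)) : R).
    have c : (2^-1 : R) ^+ n @[n --> \oo] --> (0 : R).
      by apply: cvg_expr; rewrite ger0_norm ?invr_ge0// invf_lt1// ltr1n.
    by apply: cvgMr; apply: cvgM; apply: cvgMr.
  rewrite !mulr0 => /cvgr0Pnorm_le /(_ e e0)[n _ hn]; exists n.
  by apply: le_trans (hn n (leqnn n)); rewrite expr2 ler_norm.
have [] := @simple_approx_ge0 n (fun t => complex.Re (f t) + K) (2 * K).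
- by apply: measurable_funD.
- by move=> t; have := fRe t; rewrite ler_norml; lra.
move=> l1 [ml1 hl1].
have [] := @simple_approx_ge0 n (fun t => complex.Im (f t) + K) (2 * K).
- by apply: measurable_funD.
- by move=> t; have := fIm t; rewrite ler_norml; lra.
move=> l2 [ml2 hl2].
(* The constant on [setT] undoes the two shifts by K. *)
exists ((Complex (- K) (- K), setT) :: l1 ++ scale_simple 'i%C l2); split.
  apply: measurable_simple_cons => //; apply: measurable_simple_cat => //.
  exact: measurable_simple_scale.
move=> t; rewrite simple_fct_cons simple_fct_cat simple_fct_scale.
have [r1 [-> h1]] := hl1 t; have [r2 [-> h2]] := hl2 t.
apply: le_trans hn; rewrite indicT /sqnormc !RIE /=.
set X := 2 * K * _ in h1 h2 *.
have sq (a : R) : 0 <= a <= X -> a ^+ 2 <= X ^+ 2.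
  by move=> /andP[a0 aX]; rewrite lerXn2r// nnegrE// (le_trans a0).
have := sq _ h1; have := sq _ h2.
set a := complex.Re _; set b := complex.Im _.
rewrite -sqrrN -[in X in _ -> X -> _]sqrrN => H2 H1.
have -> : 2 * X ^+ 2 = X ^+ 2 + X ^+ 2 by ring.
apply: lerD; [move: H1|move: H2]; congr (_ <= _); congr (_ ^+ 2); ring.
Qed.

End simple_functions.

(** * Isometry and existence of spectral integrals *)

Section spectral_integrals.
Context {R : realType} {d : measure_display} {T : measurableType d}.
Variable mu : {measure set T -> \bar R}.
Variables (E : set R -> (T -> R[i]) -> (T -> R[i])) (u : T -> R[i]).
Hypotheses (pE : is_pvm mu E) (Lu : L2 mu u).
Implicit Types (B : set R) (l : seq (R[i] * set R)) (z : R[i]).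

Let m : {measure set R -> \bar R} := spectral_measure pE Lu.

Lemma spectral_measureE B : spectral_measure pE Lu B = sqnorm mu (E B u).
Proof. exact: spectral_massE. Qed.

Lemma spectral_measure_fin B : measurable B -> spectral_measure pE Lu B \is a fin_num.
Proof.
by move=> mB; rewrite spectral_measureE; apply: L2_sqnorm_fin; exact: (pvm_L2 pE).
Qed.

Lemma spectral_measureT : spectral_measure pE Lu setT = sqnorm mu u.
Proof.
rewrite spectral_measureE; apply: ae_eq_sqnorm.
- by apply: (@L2_cmeasurable _ _ _ mu); exact: (pvm_L2 pE).
- exact: L2_cmeasurable Lu.
- exact: (pvm_setT pE).
Qed.

Lemma sqnorm_indic B : measurable B ->
  sqnorm m (fun t => (\1_B t)%:C%C) = spectral_measure pE Lu B.
Proof.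
move=> mB; rewrite /sqnorm -[RHS]/(m B) -(setIT B) -integral_indic//.
apply: eq_integral => t _; rewrite /sqnormc /= expr0n addr0 setIT indicE.
by case: (_ \in _); rewrite ?expr0n ?expr1n.
Qed.

Lemma L2_indic B : measurable B -> L2 m (fun t => (\1_B t)%:C%C).
Proof.
move=> mB; apply/L2P; split.
  by apply: cmeasurable_real; exact: measurable_indic.
by rewrite sqnorm_indic// -ge0_fin_numE ?spectral_measure_fin// spectral_measureE sqnorm_ge0.
Qed.

Lemma inner_indic B B' : measurable B -> measurable B' ->
  inner m (fun t => (\1_B t)%:C%C) (fun t => (\1_B' t)%:C%C) =
  (fine (spectral_measure pE Lu (B `&` B')))%:C%C.
Proof.
move=> mB mB'; have mI := measurableI _ _ mB mB'.
rewrite -sqnorm_indic// -inner_self; last exact: L2_indic.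
rewrite /inner; congr Complex; apply: eq_Rintegral => t _;
  rewrite indicI /=; first by rewrite !indicE; case: (t \in B); case: (t \in B') => /=; ring.
by ring.
Qed.

(** The vectors E(B)u and the indicators of B have the same Gram matrix, with entries m(B [&] B');
    the sets in l may therefore overlap. *)
Lemma simple_op_isometry l : measurable_simple l ->
  [/\ L2 mu (simple_op E l u), L2 m (simple_fct l) &
      sqnorm mu (simple_op E l u) = sqnorm m (simple_fct l)].
Proof.
move=> ml.
(* [inner_sum] wants every member of the family in L^2, also for pairs outside l, so nonmeasurable
   sets are replaced by [set0]. *)
pose B (q : R[i] * set R) := if pselect (measurable q.2) then q.2 else set0.
have mB q : measurable (B q) by rewrite /B; case: pselect => [h|_] /=;
  [exact: h|exact: measurable0].
have opE : simple_op E l u = (fun x => \sum_(q <- l) q.1 * E (B q) u x).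
  apply/funext => x; apply: eq_big_seq => q ql; congr (_ * E _ _ _).
  by rewrite /B; case: pselect => // nm; case: nm; exact: ml ql.
have fctE : simple_fct l = (fun t => \sum_(q <- l) q.1 * (\1_(B q) t)%:C%C).
  apply/funext => x; apply: eq_big_seq => q ql; rewrite /B.
  by case: pselect => // nm; case: nm; exact: ml ql.
have LE q : L2 mu (E (B q) u) by exact: (pvm_L2 pE).
have LI q : L2 m (fun t => (\1_(B q) t)%:C%C) by exact: L2_indic.
have Lop : L2 mu (simple_op E l u) by rewrite opE; exact: L2_sum.
have Lfct : L2 m (simple_fct l) by rewrite fctE; exact: (L2_sum l (fun q => q.1) LI).
split => //.
rewrite -(fineK (L2_sqnorm_fin Lop)) -(fineK (L2_sqnorm_fin Lfct)); congr EFin.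
apply: (@complexI R); rewrite -!inner_self//.
rewrite opE inner_sum// fctE.
rewrite (inner_sum l l (fun q => q.1) (fun q => q.1) LI LI).
apply: eq_bigr => q _; apply: eq_bigr => r _.
by rewrite pvm_inner// inner_indic// spectral_measureE.
Qed.

Lemma simple_op_cat l l' x :
  simple_op E (l ++ l') u x = simple_op E l u x + simple_op E l' u x.
Proof. by rewrite /simple_op big_cat. Qed.

Lemma simple_op_scale z l x :
  simple_op E (scale_simple z l) u x = z * simple_op E l u x.
Proof.
rewrite /simple_op big_map mulr_sumr.
by apply: eq_bigr => q _; rewrite /= mulrA.
Qed.

(** Restates the definition with the structured measure m and squared norms, where the integration
    lemmas apply. *)
Lemma spectral_integralP f v : spectral_integral mu E f u v <->
  L2 mu v /\ exists l : nat -> seq (R[i] * set R),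
    [/\ forall n, measurable_simple (l n),
        sqnorm m (fun t => simple_fct (l n) t - f t) @[n --> \oo] --> (0 : \bar R)%E &
        sqnorm mu (fun x => simple_op E (l n) u x - v x) @[n --> \oo] --> (0 : \bar R)%E].
Proof.
have h (l : nat -> seq (R[i] * set R)) : (fun n : nat => (\int[spectral_mass mu E u]_t
     ((Normc.normc (simple_fct (l n) t - f t)) ^+ 2)%:E)%E) =
     (fun n => sqnorm m (fun t => simple_fct (l n) t - f t)).
  apply/funext => n; rewrite /sqnorm; under [RHS]eq_integral do rewrite -normcX2.
  by [].
split.
  move=> [_ Lv [l [ml]]]; rewrite h => c1 /cvg_Lpnorm2 c2.
  by split => //; exists l; split.
move=> [Lv [l [ml c1 c2]]]; split => //; exists l; split => //.
  by rewrite h.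
exact/cvg_Lpnorm2.
Qed.

(** The isometry for z + f(A): prepending (z, [setT]) to the approximants adds z E(R)u = z u. The
    values z = -1, M and 0 serve u - theta_k u, (M + A)w and A^s u. *)
Lemma spectral_integral_sqnorm f v z : spectral_integral mu E f u v ->
  cmeasurable f ->
  sqnorm mu (fun x => z * u x + v x) = sqnorm m (fun t => z + f t).
Proof.
move=> /spectral_integralP[Lv [l [ml c1 c2]]] mf.
have LT : L2 mu (E setT u) by exact: (pvm_L2 pE).
have -> : sqnorm mu (fun x => z * u x + v x) = sqnorm mu (fun x => z * E setT u x + v x).
  apply: ae_eq_sqnorm.
  - exact: L2_cmeasurable (L2_lin z Lu Lv).
  - exact: L2_cmeasurable (L2_lin z LT Lv).
  by apply: filterS (pvm_setT pE Lu) => x /= /[apply] ->.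
pose l' n := (z, setT) :: l n.
have ml' n : measurable_simple (l' n) by exact: measurable_simple_cons.
have e1 n x : simple_op E (l' n) u x = z * E setT u x + simple_op E (l n) u x.
  by rewrite /simple_op big_cons.
have e2 n t : simple_fct (l' n) t = z + simple_fct (l n) t.
  by rewrite simple_fct_cons indicT mulr1.
have c1' : sqnorm m (fun t => simple_fct (l' n) t - (z + f t)) @[n --> \oo] --> (0 : \bar R)%E.
  apply: cvg_trans c1; apply: near_eq_cvg; apply: nearW => n.
  by apply: eq_sqnorm => t; rewrite e2; ring.
have c2' : sqnorm mu (fun x => simple_op E (l' n) u x - (z * E setT u x + v x))
    @[n --> \oo] --> (0 : \bar R)%E.
  apply: cvg_trans c2; apply: near_eq_cvg; apply: nearW => n.
  by apply: eq_sqnorm => t; rewrite e1; ring.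
have iso n := simple_op_isometry (ml' n).
have mop n : cmeasurable (simple_op E (l' n) u) by have [/L2_cmeasurable] := iso n.
have mfct n : cmeasurable (simple_fct (l' n)) by have [_ /L2_cmeasurable] := iso n.
have eiso n : sqnorm mu (simple_op E (l' n) u) = sqnorm m (simple_fct (l' n)).
  by have [] := iso n.
have mw := L2_cmeasurable (L2_lin z LT Lv).
have mh : cmeasurable (fun t => z + f t).
  by apply: cmeasurableD => //; exact: cmeasurable_cst.
apply/eqP; rewrite eq_le; apply/andP; split.
  exact: (le_sqnorm_lim mop mw mfct mh).
by apply: (le_sqnorm_lim mfct mh mop mw).
Qed.

(** Uniform simple approximants at rate 8^-n converge in L^2(m) because m is finite; the isometry
    carries the rate to L^2(mu), where completeness gives v. *)
Lemma bounded_spectral_integral f (I : set R) (K : R) : cmeasurable f ->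
  measurable I -> spectral_measure pE Lu (~` I) = 0%E ->
  (forall t, I t -> `|complex.Re (f t)| <= K) ->
  (forall t, I t -> `|complex.Im (f t)| <= K) ->
  exists v, spectral_integral mu E f u v.
Proof.
move=> mf mI I0 fRe fIm.
pose f' t := f t * (\1_I t)%:C%C.
have mf' : cmeasurable f'.
  by apply: cmeasurableM => //; apply: cmeasurable_real; exact: measurable_indic.
(* K may be negative when I is empty, and f' vanishes off I; hence the maximum with 0. *)
have f'Re t : `|complex.Re (f' t)| <= Num.max K 0.
  rewrite /f' RIE /= indicE; have [|] := boolP (t \in I); rewrite ?inE => It.
    by rewrite mulr1 mulr0 subr0 le_max fRe.
  by rewrite !mulr0 subr0 normr0 le_max lexx orbT.
have f'Im t : `|complex.Im (f' t)| <= Num.max K 0.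
  rewrite /f' RIE /= indicE; have [|] := boolP (t \in I); rewrite ?inE => It.
    by rewrite mulr1 mulr0 add0r le_max fIm.
  by rewrite !mulr0 addr0 normr0 le_max lexx orbT.
have e0 n : 0 < (8^-1 : R) ^+ n by rewrite exprn_gt0// invr_gt0.
have /choice[l hl] := fun n => simple_approx mf' f'Re f'Im (e0 n).
have ml n : measurable_simple (l n) by have [] := hl n.
have lf n t : sqnormc (simple_fct (l n) t - f' t) <= 8^-1 ^+ n.
  by have [_] := hl n; exact.
have Lop n : L2 mu (simple_op E (l n) u) by have [] := simple_op_isometry (ml n).
have mfct n : cmeasurable (simple_fct (l n)).
  by have [_ /L2_cmeasurable] := simple_op_isometry (ml n).
pose M := fine (m setT).
have mT : m setT = M%:E by rewrite fineK// spectral_measure_fin.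
(* Both approximants are compared with f': 2 * 8^-(n+1) + 2 * 8^-n <= 4 * 8^-n. *)
have diff n : (sqnorm mu (fun x => simple_op E (l n.+1) u x - simple_op E (l n) u x)%R
     <= (4 * M * (8^-1) ^+ n)%:E)%E.
  have -> : (fun x => simple_op E (l n.+1) u x - simple_op E (l n) u x) =
      simple_op E (l n.+1 ++ scale_simple (-1) (l n)) u.
    by apply/funext => x; rewrite simple_op_cat simple_op_scale mulN1r.
  have mll : measurable_simple (l n.+1 ++ scale_simple (-1) (l n)).
    by apply: measurable_simple_cat => //; exact: measurable_simple_scale.
  have [_ Lf ->] := simple_op_isometry mll.
  apply: (@le_trans _ _ (\int[m]_t (cst (4 * 8^-1 ^+ n)%:E t))%E).
    apply: ge0_le_integral => //.
    - by move=> t _; rewrite lee_fin sqnormc_ge0.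
    - exact: cmeasurable_EFin_sqnormc (L2_cmeasurable Lf).
    move=> t _; rewrite lee_fin simple_fct_cat simple_fct_scale mulN1r.
    have -> : simple_fct (l n.+1) t - simple_fct (l n) t =
      (simple_fct (l n.+1) t - f' t) + - (simple_fct (l n) t - f' t) by ring.
    apply: le_trans (sqnormcD_le2 _ _) _; rewrite sqnormcN.
    have := lf n t; have := lf n.+1 t; rewrite exprS; have := e0 n; lra.
  by rewrite integral_cst// mT -EFinM lee_fin mulrAC.
have [v Lv cv] := Riesz_Fischer Lop diff.
exists v; apply/spectral_integralP; split => //; exists l; split => //.
apply/ge0_cvge0P => [n|e ep]; first exact: sqnorm_ge0.
have c0 : M * (8^-1 : R) ^+ n @[n --> \oo] --> (0 : R).
  rewrite -[X in _ --> X](mulr0 M); apply: cvgMr.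
  by apply: cvg_expr; rewrite ger0_norm ?invr_ge0// invf_lt1// ltr1n.
move/cvgr0Pnorm_le : c0 => /(_ e ep); apply: filterS => n hn.
have -> : sqnorm m (fun t => simple_fct (l n) t - f t) =
    sqnorm m (fun t => simple_fct (l n) t - f' t).
  apply: ae_eq_sqnorm; [exact: cmeasurableB|exact: cmeasurableB|].
  exists (~` I); split; [exact: measurableC|exact: I0|].
  move=> t /=; apply: contra_not => It _.
  by rewrite /f' indicE mem_set// mulr1.
apply: (@le_trans _ _ (\int[m]_t (cst (8^-1 ^+ n)%:E t))%E).
  apply: ge0_le_integral => //.
  - by move=> t _; rewrite lee_fin sqnormc_ge0.
  - by apply: cmeasurable_EFin_sqnormc; exact: cmeasurableB.
  by move=> t _; rewrite lee_fin.
rewrite integral_cst// mT -EFinM lee_fin mulrC.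
exact: le_trans (ler_norm _) hn.
Qed.

End spectral_integrals.

(** * A nonnegative operator has no negative spectrum *)

Section nonnegative_spectrum.
Context {R : realType} {d : measure_display} {T : measurableType d}.
Variable mu : {measure set T -> \bar R}.
Variables (D : set (T -> R[i])) (A : (T -> R[i]) -> (T -> R[i])).
Variables (E : set R -> (T -> R[i]) -> (T -> R[i])).
Hypotheses (A_L2 : forall u, D u -> L2 mu (A u)).
Hypotheses (A_nonnegative : nonnegative mu D A) (E_spectral : spectral_measure_of mu E D A).

Let pE : is_pvm mu E := E_spectral.1.

(* For w in the range of E([-M, -1/M]), the bounded operator M + A has norm at
   most M - 1/M on w, while nonnegativity makes it at least M. *)
Lemma pvm_itv_negative (M : R) u : 1 <= M -> L2 mu u ->
  sqnorm mu (E `[- M, - M^-1]%classic u) = 0%E.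
Proof.
move=> M1 Lu; set I := `[_, _]%classic; have M0 : 0 < M by exact: lt_le_trans M1.
have mI : measurable I by exact: measurable_itv.
pose w := E I u; have Lw : L2 mu w by exact: (pvm_L2 pE).
pose m : {measure set R -> \bar R} := spectral_measure pE Lw.
have wI : spectral_measure pE Lw (~` I) = 0%E.
  rewrite spectral_measureE -(sqnorm_pvm0 pE Lu) -(setICl I).
  apply: ae_eq_sqnorm.
  - by apply: (@L2_cmeasurable _ _ _ mu); apply: (pvm_L2 pE) => //; exact: measurableC.
  - apply: (@L2_cmeasurable _ _ _ mu); apply: (pvm_L2 pE) => //.
    by apply: measurableI => //; exact: measurableC.
  have := pvm_setI pE (measurableC mI) mI Lu.
  by apply: filterS => x /= /[apply] ->.
have mid : cmeasurable (fun t : R => t%:C%C) by exact: cmeasurable_real.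
have It t : I t -> - M <= t <= - M^-1 by rewrite /I /= in_itv.
have iM : 0 < M^-1 by rewrite invr_gt0.
have iM1 : M^-1 <= M by rewrite (le_trans _ M1)// invf_le1.
have [||v hv] := @bounded_spectral_integral _ _ _ _ _ _ pE Lw (fun t => t%:C%C) I M mid mI wI.
- by move=> t /It/andP[a b] /=; rewrite ler_norml; apply/andP; split; lra.
- by move=> t _ /=; rewrite normr0 ltW.
have [Dw Lv Awv] := (E_spectral.2 w v).2 hv.
have := spectral_integral_sqnorm pE Lw M%:C%C hv mid; rewrite -/m => eqM.
pose q := fine (sqnorm mu w).
have qE : sqnorm mu w = q%:E by rewrite fineK//; exact: L2_sqnorm_fin.
have up : (sqnorm mu (fun x => M%:C%C * w x + v x)%R <= ((M - M^-1) ^+ 2 * q)%:E)%E.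
  rewrite eqM.
  apply: (@le_trans _ _ (\int[m]_t (cst ((M - M^-1) ^+ 2)%:E t))%E).
    apply: ae_ge0_le_integral => //.
    - by move=> t _; rewrite lee_fin sqnormc_ge0.
    - apply: cmeasurable_EFin_sqnormc; exact: cmeasurableD.
    - by move=> t _; rewrite lee_fin; exact: sqr_ge0.
    exists (~` I); split; [exact: measurableC|exact: wI|].
    move=> t /=; apply: contra_not => /It/andP[a b] _.
    rewrite lee_fin /sqnormc !RIE /= addr0 expr0n addr0.
    rewrite lerXn2r ?nnegrE//; lra.
  rewrite integral_cst//.
  have -> : m setT = q%:E by rewrite -qE -(spectral_measureT pE Lw).
  by rewrite EFinM.
have Lz := L2_lin M%:C%C Lw Lv.
have := sqnorm_lin M%:C%C Lw Lv; rewrite (inner_conj Lv Lw) => eq1.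
have vw : inner mu v w = inner mu (A w) w.
  apply: ae_eq_innerl => //; last by apply: filterS Awv => x /= /[apply] ->.
  exact: A_L2.
have := A_nonnegative Dw; rewrite -vw lecE => /andP[_ re0].
have {up} : fine (sqnorm mu (fun x => M%:C%C * w x + v x)) <= (M - M^-1) ^+ 2 * q.
  by rewrite -lee_fin fineK//; exact: L2_sqnorm_fin.
have v0 : 0 <= fine (sqnorm mu v) by rewrite fine_ge0// sqnorm_ge0.
have q0 : 0 <= q by rewrite fine_ge0// sqnorm_ge0.
rewrite {}eq1 -/q; move: re0; case: (inner mu v w) => a b /= a0.
rewrite /sqnormc /= expr0n /= mul0r subr0 addr0 => h.
have Ma0 : 0 <= M * a by rewrite mulr_ge0// ltW.
(* As a = Re <Aw, w> >= 0, M^2 q <= ||Mw + Aw||^2 <= (M^2 - 2 + M^-2) q, and M^-2 <= 1 forces q <=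
   0. *)
have eq2 : (M - M^-1) ^+ 2 = M ^+ 2 - 2 + M^-1 ^+ 2 by field; rewrite gt_eqF.
have iM2 : M^-1 ^+ 2 <= 1 by rewrite exprn_ile1// ?invf_le1// ltW.
rewrite -/w qE; congr EFin; move: h; rewrite eq2 => h.
have h1 : M ^+ 2 * q <= (M ^+ 2 - 2 + M^-1 ^+ 2) * q by lra.
have h2 : M^-1 ^+ 2 * q <= 1 * q by rewrite ler_wpM2r.
by apply: le_anti; rewrite q0 andbT; lra.
Qed.

(** The null intervals [-(n+1), -1/(n+1)] exhaust the negative half-line. *)
Lemma spectral_measure_nonneg u (Lu : L2 mu u) :
  \forall t \ae (spectral_measure pE Lu : {measure set R -> \bar R}), 0 <= t.
Proof.
have h n : \forall t \ae (spectral_measure pE Lu : {measure set R -> \bar R}),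
    ~ `[- n.+1%:R, - n.+1%:R^-1]%classic t.
  exists `[- n.+1%:R, - n.+1%:R^-1]%classic; split.
  - exact: measurable_itv.
  - by rewrite /= spectral_measureE pvm_itv_negative// ler1n.
  by move=> t /= /contrapT.
have := ae_foralln h; apply: filterS => t ht; rewrite leNgt; apply/negP => t0.
(* n + 1 must exceed -t for the left endpoint and 1/(-t) for the right one. *)
pose n := Num.truncn (Num.max (- t) (- t)^-1).
have := truncnS_gt (Num.max (- t) (- t)^-1); rewrite -/n => hn.
move: hn; rewrite gt_max => /andP[h1 h2].
apply: (ht n) => /=; rewrite in_itv /= lerNl ltW//= lerNr.
by rewrite -[- t]invrK lef_pV2 ?posrE ?invr_gt0 ?oppr_gt0// ltW.
Qed.

End nonnegative_spectrum.

(** * Pointwise slicing along levels *)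

Section dyadic_estimates.
Context {R : realType}.

(* Young's inequality for a^q * b^2 with exponents (q + 2)/q and (q + 2)/2. *)
Lemma powR_diff_le (a b q : R) : 0 <= a -> 0 <= b -> 0 < q ->
  b `^ (q + 2) - a `^ (q + 2) <= (q + 2) / q * (b `^ q - a `^ q) * b ^+ 2.
Proof.
move=> a0 b0 q0; have p0 : 0 < q + 2 by rewrite addr_gt0.
have E : ((q + 2) / q)^-1 + ((q + 2) / 2)^-1 = 1.
  by field; rewrite !gt_eqF.
have := @conjugate_powR R (a `^ q) (b ^+ 2) _ _ (powR_ge0 _ _) (sqr_ge0 _) _ _ E.
rewrite !divr_gt0// => /(_ isT isT).
rewrite -powRrM -powR_mulrn// -powRrM.
have -> : q * ((q + 2) / q) = q + 2 by field; rewrite gt_eqF.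
have -> : 2 * ((q + 2) / 2) = q + 2 :> R by field.
have D (x : R) : 0 <= x -> x `^ (q + 2) = x `^ q * x `^ 2.
  move=> x0; rewrite powRD//; apply/implyP => /eqP h.
  by move: p0; rewrite h ltxx.
rewrite (D b)//; set A := a `^ (q + 2); set x := a `^ q; set y := b `^ q.
set z := b `^ 2 => h.
rewrite -subr_ge0.
have -> : (q + 2) / q * (y - x) * z - (y * z - A) =
  (q + 2) / q * (A / ((q + 2) / q) + y * z / ((q + 2) / 2) - x * z).
  by field; rewrite !gt_eqF.
by rewrite mulr_ge0 ?subr_ge0// ltW// divr_gt0.
Qed.

(** Telescoping in n: raising the cap from a n to a n.+1 changes nothing when y <= a n, and
    otherwise costs one increment, bounded by [powR_diff_le]. *)
Lemma truncated_powR_le (a : nat -> R) (gamma : nat -> R) (y q : R) n :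
  0 <= y -> 0 < q -> (forall i, 0 <= a i) -> (forall i, a i <= a i.+1) ->
  (forall i, (i < n)%N -> y <= gamma i + a i / 2) ->
  (Num.min y (a n)) `^ (q + 2) - (a 0%N) `^ (q + 2) <=
  \sum_(i < n) 4 * ((q + 2) / q) * ((a i.+1) `^ q - (a i) `^ q) * (gamma i) ^+ 2.
Proof.
move=> y0 q0 a0 aS; elim: n => [|n IH] yg.
  rewrite big_ord0 subr_le0 ge0_ler_powR ?nnegrE ?le_min ?y0 ?a0//.
    by rewrite addr_ge0// ltW.
  by rewrite ge_min lexx orbT.
have pq0 : 0 <= (q + 2) / q by rewrite divr_ge0// ?addr_ge0// ltW.
rewrite big_ord_recr /=.
have {IH} := IH (fun i h => yg i (ltnW h)).
suff : (Num.min y (a n.+1)) `^ (q + 2) - (Num.min y (a n)) `^ (q + 2) <=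
  4 * ((q + 2) / q) * ((a n.+1) `^ q - (a n) `^ q) * (gamma n) ^+ 2 by lra.
have dq : 0 <= (a n.+1) `^ q - (a n) `^ q.
  by rewrite subr_ge0 ge0_ler_powR ?nnegrE// ltW.
have [yan|any] := leP y (a n).
  rewrite (min_idPl _) ?(le_trans yan)// subrr.
  by rewrite mulr_ge0 ?sqr_ge0// mulr_ge0// mulr_ge0.
set b := Num.min _ _.
have b0 : 0 <= b by rewrite le_min y0 a0.
have by_ : b <= y by rewrite ge_min lexx.
have ba : b <= a n.+1 by rewrite ge_min lexx orbT.
apply: le_trans (powR_diff_le (a0 n) b0 q0) _.
(* From a n < y the hypothesis gives y <= gamma n + y / 2; squaring this 2 yields the factor 4. *)
have yg2 : b <= 2 * gamma n by have := yg n (leqnn _); lra.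
have -> : 4 * ((q + 2) / q) * (a n.+1 `^ q - a n `^ q) * gamma n ^+ 2 =
  ((q + 2) / q) * (a n.+1 `^ q - a n `^ q) * (2 * gamma n) ^+ 2 by ring.
have bq : b `^ q <= a n.+1 `^ q by rewrite ge0_ler_powR ?nnegrE// ltW.
apply: (@le_trans _ _ ((q + 2) / q * (a n.+1 `^ q - a n `^ q) * b ^+ 2)).
  by rewrite ler_wpM2r ?sqr_ge0// ler_wpM2l// lerD2r.
apply: ler_wpM2l; first exact: mulr_ge0.
by rewrite lerXn2r// nnegrE// (le_trans b0).
Qed.

(** The partial sum never exceeds b n, so the last selected index i bounds it by b i.+1 <= X. The
    induction carries both bounds. *)
Lemma sum_increments_le (b : nat -> R) (P : nat -> bool) (X : R) n :
  0 <= b 0%N -> (forall i, b i <= b i.+1) -> 0 <= X ->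
  (forall i, P i -> b i.+1 <= X) ->
  \sum_(i < n) (b i.+1 - b i) * (P i)%:R <= X.
Proof.
move=> b0 bS X0 PX.
suff /andP[] : (\sum_(i < n) (b i.+1 - b i) * (P i)%:R <= X) &&
  (\sum_(i < n) (b i.+1 - b i) * (P i)%:R <= b n) by [].
elim: n => [|n IH]; first by rewrite big_ord0 X0 b0.
rewrite big_ord_recr /=; move: IH => /andP[h1 h2].
have bn := bS n.
have [Pn|_] := boolP (P n); last by rewrite mulr0 addr0 h1 (le_trans h2).
by have := PX _ Pn; rewrite mulr1 => ?; apply/andP; split; lra.
Qed.

End dyadic_estimates.

(** * Integrating the slices *)

Section dyadic_integral.
Context {R : realType} {d1 d2 : measure_display}.
Context {T1 : measurableType d1} {T2 : measurableType d2}.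
Variables (mu : {measure set T1 -> \bar R}) (m : {measure set T2 -> \bar R}).
(* In the application y = |u|, g k = theta(2^-k A)u - u, a k = 2 N 2^(k sigma),
   m is the spectral measure of u and P k t says that c 2^k < t. *)
Variables (y : T1 -> R) (g : int -> T1 -> R[i]) (a : int -> R) (q M2 : R).
Variables (P : int -> T2 -> bool) (X : T2 -> R).
Hypotheses (my : measurable_fun setT y) (y0 : forall x, 0 <= y x).
Hypothesis mg : forall k, cmeasurable (g k).
Hypotheses (q0 : 0 < q) (M20 : 0 <= M2).
Hypotheses (a0 : forall k, 0 <= a k) (a_nd : forall k, a k <= a (k + 1)).
Hypotheses (a_cvgNy : a (- n%:Z) @[n --> \oo] --> (0 : R))
           (a_cvgy : a n%:Z @[n --> \oo] --> +oo).
Hypotheses (mP : forall k, measurable_fun setT (P k)) (mX : measurable_fun setT X).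
Hypotheses (X0 : forall t, 0 <= X t)
           (PX : forall k t, P k t -> a (k + 1) `^ q <= X t).
Hypothesis y_le : forall k, \forall x \ae mu,
  y x <= Normc.normc (g k x) + a k / 2.
Hypothesis g_le : forall k,
  (sqnorm mu (g k) <= \int[m]_t (M2 * (P k t)%:R)%:E)%E.

Let p := q + 2.
Let p0 : 0 < p. Proof. by rewrite addr_gt0. Qed.

(** The part of y^p between the levels -n and n: it meets finitely many slices, is nonnegative, and
    increases to y^p, as monotone convergence requires. *)
Let phi n x : R := Num.max 0 ((Num.min (y x) (a n%:Z)) `^ p - a (- n%:Z) `^ p).

Let mPr k : measurable_fun setT (fun t => (P k t)%:R : R).
Proof.
have -> : (fun t => (P k t)%:R : R) = (fun t => if P k t then 1 else 0).
  by apply/funext => t; case: (P k t).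
exact: measurable_fun_ifT.
Qed.

Let a_le (j n : nat) : (j <= n)%N -> a j%:Z <= a n%:Z.
Proof.
move=> jn; rewrite -(subnK jn) addnC; elim: (n - j)%N => [|k IH]; first by rewrite addn0.
by rewrite addnS -addn1 PoszD (le_trans IH).
Qed.

Let aN_le (j n : nat) : (j <= n)%N -> a (- n%:Z) <= a (- j%:Z).
Proof.
move=> jn; rewrite -(subnK jn) addnC; elim: (n - j)%N => [|k IH]; first by rewrite addn0.
apply: le_trans IH; have := a_nd (- (j + k.+1)%:Z); congr (_ <= a _).
by rewrite addnS -addn1 PoszD opprD subrK.
Qed.

Let mphi n : measurable_fun setT (phi n).
Proof.
apply: measurable_maxr => //; apply: measurable_funB => //.
apply: (measurableT_comp (measurable_powR p)).
exact: measurable_minr.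
Qed.

(** Only finite sums are exchanged with integrals: the slices are integrated over mu one at a time,
    [g_le] moves each to m, and they are summed again under the integral over m. *)
Let phi_le n : (\int[mu]_x (phi n x)%:E <=
  (4 * (p / q) * M2)%:E * \int[m]_t (X t)%:E)%E.
Proof.
(* Levels -n to n, reindexed by 0 to 2 n. *)
pose b (i : nat) : R := a (i%:Z - n%:Z).
have b0 i : 0 <= b i by exact: a0.
have bS i : b i <= b i.+1.
  have := a_nd (i%:Z - n%:Z); congr (_ <= a _).
  by rewrite -[in RHS]addn1 PoszD addrAC.
have bqS i : b i `^ q <= b i.+1 `^ q by rewrite ge0_ler_powR ?nnegrE// ltW.
pose C i : R := 4 * (p / q) * (b i.+1 `^ q - b i `^ q).
have C0 i : 0 <= C i by rewrite mulr_ge0 ?subr_ge0// mulr_ge0// divr_ge0// ltW.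
pose k (i : nat) : int := i%:Z - n%:Z.
have mCg i : measurable_fun setT (fun x => (C i * sqnormc (g (k i) x))%:E).
  by apply/measurable_EFinP; apply: measurable_funM => //; exact: cmeasurable_sqnormc.
have Cg0 i x : (0 <= (C i * sqnormc (g (k i) x))%:E)%E.
  by rewrite lee_fin mulr_ge0// sqnormc_ge0.
have mCP i : measurable_fun setT (fun t => (C i * (M2 * (P (k i) t)%:R))%:E).
  apply/measurable_EFinP; apply: measurable_funM => //; exact: measurable_funM.
have CP0 i t : (0 <= (C i * (M2 * (P (k i) t)%:R))%:E)%E.
  by rewrite lee_fin mulr_ge0// mulr_ge0.
apply: (@le_trans _ _ (\int[mu]_x (\sum_(i < n + n) (C i * sqnormc (g (k i) x))%:E))%E).
  apply: ae_ge0_le_integral => //.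
  - by move=> x _; rewrite lee_fin le_max lexx.
  - by apply/measurable_EFinP.
  - by move=> x _; apply: sume_ge0 => i _.
  - exact: emeasurable_sum.
  have := ae_foralln (fun i => y_le (k i)); apply: filterS => x yx _.
  rewrite sumEFin lee_fin /phi ge_max; apply/andP; split.
    by apply: sumr_ge0 => i _; rewrite mulr_ge0// sqnormc_ge0.
  have := @truncated_powR_le _ b (fun i => Normc.normc (g (k i) x)) (y x) q (n + n)
    (y0 x) q0 b0 bS (fun i _ => yx i).
  rewrite /b PoszD addrK sub0r => h; apply: le_trans h _.
  by apply: ler_sum => i _; rewrite normcX2.
rewrite ge0_integral_sum//.
apply: (@le_trans _ _ (\int[m]_t (\sum_(i < n + n) (C i * (M2 * (P (k i) t)%:R))%:E))%E).
  rewrite ge0_integral_sum//.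
  apply: lee_sum => i _.
  under eq_integral do rewrite EFinM.
  under [leRHS]eq_integral do rewrite EFinM.
  rewrite !ge0_integralZl_EFin//.
  - by apply: lee_wpmul2l; [rewrite lee_fin|exact: g_le].
  - by move=> t _; rewrite lee_fin mulr_ge0.
  - by apply/measurable_EFinP; exact: measurable_funM.
  - by move=> t _; rewrite lee_fin sqnormc_ge0.
  - exact: cmeasurable_EFin_sqnormc.
have K0 : 0 <= 4 * (p / q) * M2 by rewrite mulr_ge0// mulr_ge0// divr_ge0// ltW.
rewrite -ge0_integralZl_EFin//; last 2 first.
- by move=> t _; rewrite lee_fin.
- exact/measurable_EFinP.
apply: ge0_le_integral => //.
- by move=> t _; apply: sume_ge0 => i _.
- exact: emeasurable_sum.
- by apply: emeasurable_funM => //; exact/measurable_EFinP.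
move=> t _; rewrite sumEFin -EFinM lee_fin.
have -> : \sum_(i < n + n) C i * (M2 * (P (k i) t)%:R) = (4 * (p / q) * M2) *
    \sum_(i < n + n) (b i.+1 `^ q - b i `^ q) * (P (k i) t)%:R.
  by rewrite mulr_sumr; apply: eq_bigr => i _; rewrite /C; ring.
apply: ler_wpM2l => //.
apply: (@sum_increments_le _ (fun i => b i `^ q) (fun i => P (k i) t)) => //.
  exact: powR_ge0.
move=> i /PX; congr (_ `^ _ <= _); congr a.
by rewrite /k -[in RHS]addn1 PoszD addrAC.
Qed.

Lemma dyadic_integral_le : (\int[mu]_x (y x `^ (q + 2))%:E <=
  (4 * ((q + 2) / q) * M2)%:E * \int[m]_t (X t)%:E)%E.
Proof.
have nd x : {homo (fun n => (phi n x)%:E) : n j / (n <= j)%N >-> (n <= j)%E}.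
  move=> n j nj; rewrite lee_fin /phi.
  have h1 : Num.min (y x) (a n%:Z) `^ p <= Num.min (y x) (a j%:Z) `^ p.
    have min0 i : 0 <= Num.min (y x) (a i) by rewrite le_min y0 a0.
    have min_le : Num.min (y x) (a n%:Z) <= Num.min (y x) (a j%:Z).
      by rewrite le_min !ge_min lexx (a_le nj) orbT.
    by rewrite ge0_ler_powR ?nnegrE// ltW.
  have h2 : a (- j%:Z) `^ p <= a (- n%:Z) `^ p.
    by rewrite ge0_ler_powR ?nnegrE ?aN_le// ltW.
  rewrite ge_max !le_max lexx /=; apply/orP; right; lra.
have lim_phi x : (phi n x)%:E @[n --> \oo] --> (y x `^ p)%:E.
  apply: cvg_EFin; first exact: nearW.
  have : Num.max 0 (y x `^ p - a (- n%:Z) `^ p) @[n --> \oo] --> y x `^ p.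
    have c0 : a (- n%:Z) `^ p @[n --> \oo] --> (0 : R).
      apply/cvgr0Pnorm_le => e e0.
      have ep : 0 < e `^ p^-1 by rewrite powR_gt0.
      move/cvgr0Pnorm_le : a_cvgNy => /(_ _ ep); apply: filterS => n.
      rewrite !ger0_norm ?powR_ge0// => h.
      have -> : e = (e `^ p^-1) `^ p by rewrite -powRrM mulVf ?gt_eqF// powRr1// ltW.
      by rewrite ge0_ler_powR ?nnegrE ?powR_ge0// ltW.
    have c1 : y x `^ p - a (- n%:Z) `^ p @[n --> \oo] --> y x `^ p - 0.
      by apply: cvgB => //; exact: cvg_cst.
    rewrite subr0 in c1.
    apply/cvgrPdist_le => e e0; move/cvgrPdist_le : c1 => /(_ e e0).
    apply: filterS => n; apply: le_trans.
    have := powR_ge0 (y x) p; set L := y x `^ p; set z := a _ `^ p => L0.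
    have [zL|Lz] := leP 0 (L - z); first by [].
    by rewrite subr0 (ger0_norm L0) ler_normr; apply/orP; left; lra.
  (* Once a n >= y x the cap is inactive, and [phi] coincides with the expression whose limit is
     known. *)
  apply: cvg_trans; apply: near_eq_cvg.
  move/cvgryPge : a_cvgy => /(_ (y x)); apply: filterS => n hn.
  by move=> /=; rewrite /phi (min_idPl hn).
have -> : (\int[mu]_x (y x `^ (q + 2))%:E = \int[mu]_x (limn (fun n => (phi n x)%:E)))%E.
  by apply: eq_integral => x _; apply/esym/cvg_lim.
rewrite monotone_convergence//.
- apply: lime_le; last exact: nearW.
  apply: ereal_nondecreasing_is_cvgn => n j nj; apply: ge0_le_integral => //.
  - by move=> x _; rewrite lee_fin le_max lexx.
  - exact/measurable_EFinP.
  - exact/measurable_EFinP.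
  by move=> x _; exact: nd.
- by move=> n; exact/measurable_EFinP.
- by move=> n x _; rewrite lee_fin le_max lexx.
Qed.

End dyadic_integral.

(** * The cutoff: measurability, boundedness, and its sup norm *)

Section cutoff_function.
Context {R : realType}.
Variable theta : R -> R[i].
Hypothesis theta_continuous : continuous (theta : R -> R[i]^o).

Lemma ler_normc_Re (z : R[i]) : `|complex.Re z| <= Normc.normc z.
Proof.
case: z => x y; rewrite /= -sqrtr_sqr ler_wsqrtr// lerDl.
exact: sqr_ge0.
Qed.

Lemma ler_normc_Im (z : R[i]) : `|complex.Im z| <= Normc.normc z.
Proof.
case: z => x y; rewrite /= -sqrtr_sqr ler_wsqrtr// lerDr.
exact: sqr_ge0.
Qed.

(** The norm of [R[i]^o] takes values in R[i]; this brings continuity back to real radii. *)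
Let near_theta (t e : R) : 0 < e ->
  \forall t' \near t, Normc.normc (theta t - theta t') < e.
Proof.
move=> e0.
have e0' : (0 : R[i]) < e%:C%C by rewrite ltcR.
have /cvgrPdist_lt/(_ _ e0') := @theta_continuous t.
apply: filterS => t'; rewrite normc_def ltcR.
by case: (theta t - theta t').
Qed.

Lemma continuous_Re : continuous (fun t => complex.Re (theta t)).
Proof.
move=> t; apply/cvgrPdist_lt => e /(near_theta t); apply: filterS => t' h.
by rewrite -ReN -ReD (le_lt_trans (ler_normc_Re _)).
Qed.

Lemma continuous_Im : continuous (fun t => complex.Im (theta t)).
Proof.
move=> t; apply/cvgrPdist_lt => e /(near_theta t); apply: filterS => t' h.
by rewrite -ImN -ImD (le_lt_trans (ler_normc_Im _)).
Qed.

Lemma continuous_cmeasurable : cmeasurable theta.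
Proof.
split; apply: continuous_measurable_fun; [exact: continuous_Re|exact: continuous_Im].
Qed.

Lemma continuous_support_bounded (f : R -> R) (B : R) : continuous f ->
  (forall t, B < `|t| -> f t = 0) -> exists K, forall t, `|f t| <= K.
Proof.
move=> cf fB.
have : bounded_set (f @` `[- B, B]%classic).
  apply: compact_bounded; apply: continuous_compact; last exact: segment_compact.
  exact: continuous_subspaceT.
move=> [K [_ /(_ (Num.max K 0 + 1))]]; rewrite ltr_pwDr ?le_max ?lexx// => /(_ isT) h.
exists (Num.max K 0 + 1) => t; have [Bt|tB] := ltP B `|t|.
  by rewrite fB// normr0 addr_ge0// le_max lexx orbT.
by apply: h; exists t => //=; rewrite in_itv /= -ler_norml.
Qed.

Lemma compact_support_bounded : compact (closure [set t | theta t != 0]) ->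
  exists K, forall t, `|complex.Re (theta t)| <= K /\ `|complex.Im (theta t)| <= K.
Proof.
move=> /compact_bounded[B [_ /(_ (B + 1))]]; rewrite ltrDl ltr01 => /(_ isT) hB.
have theta0 t : B + 1 < `|t| -> theta t = 0.
  move=> Bt; apply/eqP; apply: contraTT Bt => tt; rewrite -leNgt.
  by apply: hB; apply: subset_closure.
have [K1 h1] := @continuous_support_bounded _ (B + 1) continuous_Re
  (fun t h => congr1 (@complex.Re R) (theta0 t h)).
have [K2 h2] := @continuous_support_bounded _ (B + 1) continuous_Im
  (fun t h => congr1 (@complex.Im R) (theta0 t h)).
exists (Num.max K1 K2) => t; rewrite !le_max h1 h2 orbT; split => //.
Qed.

Lemma Lpnorm_lebesgue_pinftyE (f : R -> R[i]) :
  Lpnorm lebesgue_measure +oo f =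
  ess_sup lebesgue_measure (fun t => (Normc.normc (f t))%:E).
Proof.
(* The L^oo norm is defined by cases on whether the whole space has positive measure; the unit ball
   shows that the line does. *)
rewrite /Lpnorm unlock /= ifT; last first.
  have : (lebesgue_measure (ball (0 : R)%R 1%R) <= lebesgue_measure (@setT R))%E.
    by apply: le_measure; rewrite ?inE//; exact: measurable_ball.
  by apply: lt_le_trans; rewrite lebesgue_measure_ball// lte_fin.
by congr ess_sup; apply/funext => t; rewrite /= ger0_norm// normc_ge0.
Qed.

(** If |1 - theta| exceeded its essential supremum M at one point, continuity would make it do so on
    a ball, which has positive Lebesgue measure. The pointwise form is what integration against m
    needs. *)
Lemma ess_sup_cutoff : compact (closure [set t | theta t != 0]) ->
  exists M, [/\ 0 <= M, Lpnorm lebesgue_measure +oo (fun t => 1 - theta t) = M%:E &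
    forall t, sqnormc (1 - theta t) <= M ^+ 2].
Proof.
move=> /compact_support_bounded[K hK].
have L0 : (0 <= Lpnorm lebesgue_measure +oo (fun t => 1 - theta t)%R)%E.
  exact: Lnorm_ge0.
have Loo : (Lpnorm lebesgue_measure +oo (fun t => 1 - theta t)%R <= (1 + K + K)%:E)%E.
  rewrite Lpnorm_lebesgue_pinftyE; apply/ess_supP; apply: nearW => t.
  rewrite lee_fin -ler_sqr ?nnegrE ?normc_ge0//; last first.
    by have [h1 h2] := hK 0; rewrite !addr_ge0// (le_trans _ h1).
  rewrite normcX2 /sqnormc !RIE /=.
  have [] := hK t; set x := complex.Re _; set z := complex.Im _ => hx hz.
  have K0 : 0 <= K by exact: le_trans hx.
  have h1 : (1 - x) ^+ 2 <= (1 + K) ^+ 2.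
    rewrite -[leLHS]real_normK ?num_real// lerXn2r// ?nnegrE ?addr_ge0//.
    by rewrite (le_trans (ler_normB _ _))// normr1 lerD2l.
  have h2 : (0 - z) ^+ 2 <= K ^+ 2.
    by rewrite sub0r sqrrN -[leLHS]real_normK ?num_real// lerXn2r// nnegrE.
  have := mulr_ge0 K0 K0; move: h1 h2; rewrite !expr2; lra.
have Lf : Lpnorm lebesgue_measure +oo (fun t => 1 - theta t) \is a fin_num.
  by rewrite ge0_fin_numE// (le_lt_trans Loo)// ltry.
pose M := fine (Lpnorm lebesgue_measure +oo (fun t => 1 - theta t)).
have M0 : 0 <= M by rewrite fine_ge0.
exists M; split => //; first by rewrite fineK.
move=> t; rewrite leNgt; apply/negP => tM.
have : continuous (fun t => sqnormc (1 - theta t)).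
  have -> : (fun t => sqnormc (1 - theta t)) = (fun t =>
      (1 - complex.Re (theta t)) * (1 - complex.Re (theta t)) +
      (0 - complex.Im (theta t)) * (0 - complex.Im (theta t))).
    by apply/funext => t'; rewrite /sqnormc !RIE /= !expr2.
  move=> t'.
  have cRe := @continuous_Re t'; have cIm := @continuous_Im t'.
  by apply: cvgD; apply: cvgM; apply: cvgB => //; exact: cvg_cst.
move=> /(_ t) /cvgrPdist_lt /(_ _ (_ : 0 < sqnormc (1 - theta t) - M ^+ 2)).
rewrite subr_gt0 => /(_ tM) /nbhs_ballP[e /= e0 he].
have ae : \forall t \ae lebesgue_measure, ((Normc.normc (1 - theta t))%:E <= M%:E)%E.
  by rewrite fineK// Lpnorm_lebesgue_pinftyE; exact: ess_sup_ge.
case: ae => N [mN N0 hN].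
have : (lebesgue_measure (ball t e) <= lebesgue_measure N)%E.
  apply: le_measure; rewrite ?inE//; first exact: measurable_ball.
  move=> t' tt'; apply: hN => /=; rewrite lee_fin => h.
  have := he _ tt'; rewrite /= ltr_norml => /andP[_].
  have : sqnormc (1 - theta t') <= M ^+ 2.
    by rewrite -normcX2 lerXn2r// nnegrE normc_ge0.
  lra.
rewrite N0 lebesgue_measure_ball; last exact: ltW.
by rewrite lee_fin leNgt mulrn_wgt0.
Qed.

End cutoff_function.

(** * The norms of the statement in usable form *)

Section Lpnorm_facts.
Context {R : realType} {d : measure_display} {T : measurableType d}.
Variable mu : {measure set T -> \bar R}.
Implicit Types u : T -> R[i].

Lemma cmeasurable_normc u : cmeasurable u ->
  measurable_fun setT (fun x => Normc.normc (u x)).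
Proof.
move=> mu_; have -> : (fun x => Normc.normc (u x)) = (fun x => sqnormc (u x) `^ 2^-1).
  apply/funext => x; rewrite -normcX2 -powR_mulrn ?normc_ge0// -powRrM mulfV//.
  by rewrite powRr1// normc_ge0.
exact: (measurableT_comp (measurable_powR _) (cmeasurable_sqnormc mu_)).
Qed.

Lemma LpnormE (p : R) u :
  Lpnorm mu p%:E u = ((\int[mu]_x (Normc.normc (u x) `^ p)%:E) `^ p^-1)%E.
Proof.
rewrite /Lpnorm unlock; congr (_ `^ _)%E; apply: eq_integral => x _.
by rewrite /= ger0_norm// normc_ge0.
Qed.

Lemma ae_le_Lpnorm_pinfty u :
  \forall x \ae mu, ((Normc.normc (u x))%:E <= Lpnorm mu +oo u)%E.
Proof.
rewrite /Lpnorm unlock; case: ifPn => [_|mu0].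
  have := ess_sup_ge mu (abse \o (fun x => (Normc.normc (u x))%:E)).
  by apply: filterS => x; rewrite /= ger0_norm// normc_ge0.
exists setT; split => //; apply/eqP.
by move: mu0; rewrite lt_neqAle measure_ge0 andbT negbK eq_sym.
Qed.

End Lpnorm_facts.

Section Bdot.
Context {R : realType} {d : measure_display} {T : measurableType d}.
Variable mu : {measure set T -> \bar R}.
Variable E : set R -> (T -> R[i]) -> (T -> R[i]).
Variables (theta : R -> R[i]) (sigma : R) (u : T -> R[i]).

Lemma Bdot_norm_ge0 : (0 <= Bdot_norm mu E theta sigma u)%E.
Proof.
apply: le_trans (ereal_sup_ubound _); last by exists 0.
by rewrite mule_ge0 ?lee_fin ?powR_ge0//; exact: Lnorm_ge0.
Qed.

(** N is any upper bound, so that a positive one is available when the norm vanishes. *)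
Lemma ae_le_Bdot_norm (N : R) (k : int) : (Bdot_norm mu E theta sigma u <= N%:E)%E ->
  \forall x \ae mu, Normc.normc
    (fcalc mu E (fun t => theta ((2 : R) ^ (- k) * t)) u x) <=
    N * 2 `^ (k%:~R * sigma).
Proof.
move=> BN; set v := fcalc _ _ _ _.
have : ((2 `^ (- (k%:~R * sigma)))%:E * Lpnorm mu +oo v <= N%:E)%E.
  by apply: le_trans BN; apply: ereal_sup_ubound; exists k.
move=> h; have L : (Lpnorm mu +oo v <= (N * 2 `^ (k%:~R * sigma))%:E)%E.
  have P0 : (0 <= (2 `^ (k%:~R * sigma))%:E :> \bar R)%E by rewrite lee_fin powR_ge0.
  have := lee_wpmul2l P0 h; rewrite muleA -EFinM powRN mulfV ?gt_eqF ?powR_gt0//.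
  by rewrite mul1e -EFinM mulrC.
have := ae_le_Lpnorm_pinfty mu v; apply: filterS => x hx.
by rewrite -lee_fin (le_trans hx).
Qed.

End Bdot.

Section fcalc_norms.
Context {R : realType} {d : measure_display} {T : measurableType d}.
Variable mu : {measure set T -> \bar R}.
Variables (E : set R -> (T -> R[i]) -> (T -> R[i])) (u : T -> R[i]).
Hypotheses (pE : is_pvm mu E) (Lu : L2 mu u).

Let m : {measure set R -> \bar R} := spectral_measure pE Lu.

Lemma fcalcP f : fcalc_dom mu E f u -> spectral_integral mu E f u (fcalc mu E f u).
Proof. exact: xgetPex. Qed.

Lemma sqnorm_fcalc_power (s : R) : fcalc_dom mu E (power_fct s) u ->
  sqnorm mu (fcalc mu E (power_fct s) u) = (\int[m]_t ((t `^ s) ^+ 2)%:E)%E.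
Proof.
move=> /fcalcP hv.
have mf : cmeasurable (power_fct s : R -> R[i]).
  by apply: cmeasurable_real; exact: measurable_powR.
have := spectral_integral_sqnorm pE Lu 0 hv mf.
under eq_sqnorm do rewrite mul0r add0r.
move=> ->; apply: eq_integral => t _.
by rewrite add0r /sqnormc /= expr0n addr0.
Qed.

End fcalc_norms.

Section dyadic_sequence.
Context {R : realType}.

Lemma cvg_powR_dyadicN (K sigma : R) : 0 < K -> 0 < sigma ->
  K * 2 `^ ((- n%:Z)%:~R * sigma) @[n --> \oo] --> (0 : R).
Proof.
move=> K0 s0.
have b1 : 1 < 2 `^ sigma :> R.
  have := @gt0_ltr_powR R sigma s0 1 2; rewrite !nnegrE powR1 => h.
  by apply: h; rewrite ?ler01 ?ler0n ?ltr1n.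
rewrite -[X in _ --> X](mulr0 K); apply: cvgMr.
have : ((2 `^ sigma)^-1) ^+ n @[n --> \oo] --> (0 : R).
  apply: cvg_expr; have b0 : 0 < 2 `^ sigma :> R by rewrite powR_gt0.
  rewrite ger0_norm; last by rewrite invr_ge0 ltW.
  by rewrite invf_lt1.
apply: cvg_trans; apply: near_eq_cvg; apply: nearW => n /=.
by rewrite mulrNz mulNr powRN mulrC powRrM powR_mulrn ?powR_ge0// exprVn.
Qed.
Lemma cvg_powR_dyadic (K sigma : R) : 0 < K -> 0 < sigma ->
  K * 2 `^ (n%:Z%:~R * sigma) @[n --> \oo] --> +oo.
Proof.
move=> K0 s0; apply/cvgryPge => B.
have B1 : 0 < `|B| + 1 by rewrite ltr_wpDl.
have := @cvg_powR_dyadicN 1 sigma ltr01 s0.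
move/cvgr0Pnorm_le => /(_ (K / (`|B| + 1)) (divr_gt0 K0 B1)); apply: filterS => n.
rewrite mul1r ger0_norm ?powR_ge0// mulrNz mulNr powRN ler_pdivlMr//.
rewrite mulrC ler_pdivrMr ?powR_gt0// => h.
by apply: le_trans h; rewrite (le_trans (ler_norm _))// lerDl.
Qed.

End dyadic_sequence.

(** * The integral estimate for u *)

Section besov_estimate.
Context {R : realType} {d : measure_display} {T : measurableType d}.
Variable mu : {measure set T -> \bar R}.
Variables (E : set R -> (T -> R[i]) -> (T -> R[i])) (u : T -> R[i]).
Hypotheses (pE : is_pvm mu E) (Lu : L2 mu u).
Hypothesis spectrum_ge0 :
  \forall t \ae (spectral_measure pE Lu : {measure set R -> \bar R}), 0 <= t.
Variables (theta : R -> R[i]) (K M c : R).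
Hypotheses (mtheta : cmeasurable theta) (M0 : 0 <= M) (c0 : 0 < c).
Hypothesis theta_bounded :
  forall t, `|complex.Re (theta t)| <= K /\ `|complex.Im (theta t)| <= K.
Hypothesis theta_le : forall t, sqnormc (1 - theta t) <= M ^+ 2.
Hypothesis theta_eq1 : forall t, - c <= t <= c -> theta t = 1.

Let m : {measure set R -> \bar R} := spectral_measure pE Lu.
Let theta_ (k : int) t : R[i] := theta ((2 : R) ^ (- k) * t).

Let mtheta_ k : cmeasurable (theta_ k).
Proof.
have ms : measurable_fun setT (fun t : R => (2 : R) ^ (- k) * t).
  exact: measurable_funM.
by split; [exact: (measurableT_comp mtheta.1 ms)|exact: (measurableT_comp mtheta.2 ms)].
Qed.

Lemma spectral_integral_cutoff k :
  spectral_integral mu E (theta_ k) u (fcalc mu E (theta_ k) u).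
Proof.
apply: fcalcP; apply: (@bounded_spectral_integral _ _ _ _ _ _ pE Lu _ setT K) => //.
- by rewrite setCT measure0.
- by move=> t _; have [] := theta_bounded ((2 : R) ^ (- k) * t).
- by move=> t _; have [] := theta_bounded ((2 : R) ^ (- k) * t).
Qed.

Lemma sqnorm_high_frequency k :
  (sqnorm mu (fun x => -1 * u x + fcalc mu E (theta_ k) u x)%R <=
   \int[m]_t (M ^+ 2 * ((c * 2 ^ k < t)%R : nat)%:R)%:E)%E.
Proof.
rewrite (spectral_integral_sqnorm pE Lu _ (spectral_integral_cutoff k))//.
have mlt : measurable_fun setT (fun t : R => (c * 2 ^ k < t)%R).
  exact: measurable_fun_ltr.
apply: ae_ge0_le_integral => //.
- by move=> t _; rewrite lee_fin sqnormc_ge0.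
- by apply: cmeasurable_EFin_sqnormc; apply: cmeasurableD.
- by move=> t _; rewrite lee_fin mulr_ge0// sqr_ge0.
- apply/measurable_EFinP; apply: measurable_funM => //.
  have -> : (fun t : R => ((c * 2 ^ k < t)%R : nat)%:R : R) =
      (fun t => if c * 2 ^ k < t then 1 else 0).
    by apply/funext => t; case: (_ < _).
  exact: measurable_fun_ifT.
(* For t >= 0, t <= c 2^k places 2^-k t in [-c, c], where 1 - theta vanishes. *)
apply: filterS spectrum_ge0 => t t0 _; rewrite lee_fin.
rewrite -sqnormcN opprD opprK; have [tk|tk] := ltP.
  by rewrite mulr1 theta_le.
rewrite /theta_ theta_eq1 ?subrr ?sqnormc0 ?mulr0//.
have k0 : 0 < (2 : R) ^ (- k) by rewrite exprz_gt0.
apply/andP; split.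
  by apply: (@le_trans _ _ 0); rewrite ?oppr_le0 ?mulr_ge0// ltW.
apply: (@le_trans _ _ ((2 : R) ^ (- k) * (c * 2 ^ k))); first by rewrite ler_wpM2l// ltW.
by rewrite mulrCA -expfzDr// addNr expr0z mulr1.
Qed.

Lemma besov_estimate (N s sigma q : R) : 0 < N -> 0 < s -> 0 < sigma ->
  q = 2 * s / sigma ->
  fcalc_dom mu E (power_fct s) u -> (Bdot_norm mu E theta sigma u <= N%:E)%E ->
  (\int[mu]_x (Normc.normc (u x) `^ (q + 2))%:E <=
   (4 * ((q + 2) / q) * M ^+ 2)%:E *
   (((2 * N) `^ q * (2 / c) `^ (2 * s))%:E *
    sqnorm mu (fcalc mu E (power_fct s) u)))%E.
Proof.
move=> N0 s0 sigma0 qE us BN.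
have q0 : 0 < q by rewrite qE divr_gt0// mulr_gt0.
(* As sigma q = 2 s, a_(k+1)^q = (2 N)^q (2^(k+1))^(2 s), and c 2^k < t gives 2^(k+1) <= 2 t / c. *)
pose X t : R := (2 * N) `^ q * (2 / c) `^ (2 * s) * (t `^ s) ^+ 2.
have K0 : 0 <= (2 * N) `^ q * (2 / c) `^ (2 * s) by rewrite mulr_ge0 ?powR_ge0.
have mps : measurable_fun setT (fun t : R => (t `^ s) ^+ 2).
  by apply: measurable_funX; exact: measurable_powR.
have -> : (((2 * N) `^ q * (2 / c) `^ (2 * s))%:E *
    sqnorm mu (fcalc mu E (power_fct s) u) = \int[m]_t (X t)%:E)%E.
  rewrite (sqnorm_fcalc_power pE Lu us) -ge0_integralZl_EFin//.
    by move=> t _; rewrite lee_fin sqr_ge0.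
  exact/measurable_EFinP.
apply: (@dyadic_integral_le _ _ _ _ _ mu m _
  (fun k x => -1 * u x + fcalc mu E (theta_ k) u x)
  (fun k => 2 * N * 2 `^ (k%:~R * sigma)) q (M ^+ 2)
  (fun k t => c * 2 ^ k < t) X) => //.
- exact: cmeasurable_normc (L2_cmeasurable Lu).
- by move=> x; exact: normc_ge0.
- move=> k; apply: L2_cmeasurable (L2_lin (-1) Lu _).
  by have [] := spectral_integral_cutoff k.
- exact: sqr_ge0.
- by move=> k; rewrite mulr_ge0 ?powR_ge0// mulr_ge0// ltW.
- move=> k; apply: ler_wpM2l; first by rewrite mulr_ge0// ltW.
  rewrite ler_powR ?ler1n// ler_wpM2r ?ltW//.
  by rewrite intrD ltrDl.
- by apply: cvg_powR_dyadicN => //; rewrite mulr_gt0.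
- by apply: cvg_powR_dyadic => //; rewrite mulr_gt0.
- by move=> k; exact: measurable_fun_ltr.
- exact: measurable_funM.
- by move=> t; rewrite mulr_ge0// sqr_ge0.
- move=> k t kt.
  have t0 : 0 < t by apply: le_lt_trans kt; rewrite mulr_ge0 ?ltW// exprz_gt0.
  have ck : 2 ^ (k + 1) <= 2 / c * t.
    rewrite expfzDr// expr1z.
    have -> : 2 / c * t = c^-1 * t * 2 by ring.
    by rewrite ler_wpM2r// ler_pdivlMl// ltW.
  have N2 : 0 <= 2 * N by rewrite mulr_ge0// ltW.
  have c2 : 0 <= 2 / c by rewrite divr_ge0// ltW.
  have t0' := ltW t0.
  rewrite /X powRM ?powR_ge0// -mulrA ler_wpM2l ?powR_ge0//.
  have e1 : (2 `^ ((k + 1)%:~R * sigma)) `^ q = (2 ^ (k + 1)) `^ (2 * s) :> R.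
    rewrite -powRrM -powR_intmul// -powRrM; congr (_ `^ _).
    by rewrite qE; field; rewrite gt_eqF.
  rewrite e1 -powR_mulrn ?powR_ge0// -powRrM (mulrC s) -powRM//.
  have s2 : 0 <= 2 * s by rewrite mulr_ge0// ltW.
  have k2 : 0 <= 2 ^ (k + 1) :> R by exact: exprz_ge0.
  have ct : 0 <= 2 / c * t by exact: mulr_ge0.
  by rewrite ge0_ler_powR.
- move=> k; have := ae_le_Bdot_norm k BN; apply: filterS => x hx.
  have -> : u x = - (-1 * u x + fcalc mu E (theta_ k) u x) + fcalc mu E (theta_ k) u x.
    by ring.
  apply: le_trans (le_normcD _ _) _.
  rewrite normcN; apply: lerD.
    by rewrite le_eqVlt; apply/orP; left; apply/eqP; congr Normc.normc; ring.
  by apply: le_trans hx _; rewrite le_eqVlt; apply/orP; left; apply/eqP; field.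
by move=> k; exact: sqnorm_high_frequency.
Qed.

End besov_estimate.

(** * The interpolation inequality with its explicit constant *)

Theorem proposition1 (R : realType) (d : measure_display)
    (T : measurableType d) (mu : {measure set T -> \bar R})
    (D : set (T -> R[i])) (A : (T -> R[i]) -> (T -> R[i]))
    (A_selfadjoint : selfadjoint mu D A)
    (A_nonnegative : nonnegative mu D A)
    (E : set R -> (T -> R[i]) -> (T -> R[i]))
    (E_spectral : spectral_measure_of mu E D A)
    (theta : R -> R[i])
    (theta_continuous : continuous (theta : R -> R[i]^o))
    (theta_compact_support : compact (closure [set t | theta t != 0]))
    (c : R) (c_gt0 : 0 < c)
    (theta_eq1 : forall t, - c <= t <= c -> theta t = 1)
    (s sigma : R) (s_gt0 : 0 < s) (sigma_gt0 : 0 < sigma) :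
  let p : R := 2 * (sigma + s) / sigma in
  let C : \bar R :=
    (2%:E * Lpnorm lebesgue_measure +oo (fun t : R => 1 - theta t)%R `^ (2 / p)
     * ((p / (p - 2)) `^ p^-1)%:E
     * ((2 / c) `^ (sigma * ((p - 2) / p)))%:E)%E in
  forall u : T -> R[i],
    fcalc_dom mu E (power_fct s) u ->
    (Bdot_norm mu E theta sigma u < +oo)%E ->
    (Lpnorm mu p%:E u <=
       C * Bdot_norm mu E theta sigma u `^ (1 - 2 / p)
         * Hdot_norm mu E s u `^ (2 / p))%E.
Proof.
move=> p C u us BN.
have A_L2 : forall w, D w -> L2 mu (A w) by have [[]] := A_selfadjoint.
have Lu : L2 mu u by case: us => v [].
have [K hK] := compact_support_bounded theta_continuous theta_compact_support.
have [M [M0 ME hM]] := ess_sup_cutoff theta_continuous theta_compact_support.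
have sp := @spectral_measure_nonneg _ _ _ mu D A E A_L2 A_nonnegative E_spectral u Lu.
pose q := 2 * s / sigma.
have q0 : 0 < q by rewrite /q divr_gt0// mulr_gt0.
have pq : p = q + 2 by rewrite /p /q; field; rewrite gt_eqF.
have p0 : 0 < p by rewrite pq addr_gt0.
have Bf : Bdot_norm mu E theta sigma u \is a fin_num.
  by rewrite ge0_fin_numE// Bdot_norm_ge0.
pose N := fine (Bdot_norm mu E theta sigma u).
have N0 : 0 <= N by rewrite fine_ge0// Bdot_norm_ge0.
have NE : Bdot_norm mu E theta sigma u = N%:E by rewrite fineK.
have [_ Lv _] := fcalcP us.
pose h := fine (sqnorm mu (fcalc mu E (power_fct s) u)).
have h0 : 0 <= h by rewrite fine_ge0// sqnorm_ge0.
have hE : sqnorm mu (fcalc mu E (power_fct s) u) = h%:E.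
  by rewrite fineK//; exact: L2_sqnorm_fin.
pose Z := (\int[mu]_x (Normc.normc (u x) `^ p)%:E)%E.
pose B := 4 * (p / q) * M ^+ 2 * (2 `^ q * (2 / c) `^ (2 * s) * h).
have c2 : 0 <= 2 / c by rewrite divr_ge0// ltW.
have pq0 : 0 <= p / q by rewrite divr_ge0// ltW.
have B0 : 0 <= B.
  have M20 : 0 <= M ^+ 2 by exact: sqr_ge0.
  have P1 : 0 <= 2 `^ q :> R by exact: powR_ge0.
  have P2 : 0 <= (2 / c) `^ (2 * s) by exact: powR_ge0.
  have P0 : 0 <= 4 * (p / q) by exact: mulr_ge0.
  by apply: mulr_ge0; apply: mulr_ge0 => //; apply: mulr_ge0.
have ZN' (N' : R) : 0 < N' -> N <= N' -> (Z <= (B * N' `^ q)%:E)%E.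
  move=> N'0 NN'.
  have BN' : (Bdot_norm mu E theta sigma u <= N'%:E)%E by rewrite NE lee_fin.
  have := besov_estimate sp (continuous_cmeasurable theta_continuous) c_gt0 hK
    hM theta_eq1 N'0 s_gt0 sigma_gt0 erefl us BN'.
  rewrite -/q -pq hE -!EFinM => hZ; apply: le_trans hZ _; rewrite lee_fin.
  rewrite powRM//; last exact: ltW.
  by rewrite le_eqVlt; apply/orP; left; apply/eqP; rewrite /B; ring.
have ZN : (Z <= (B * N `^ q)%:E)%E.
  (* For N = 0 the bound at N' = (e / (B + 1))^(1/q) is B e / (B + 1) <= e for every e > 0, whence Z
     <= 0. *)
  have [N00|Nneq0] := eqVneq N 0; last by apply: ZN' => //; rewrite lt_neqAle eq_sym Nneq0.
  rewrite N00 powR0 ?gt_eqF// mulr0; apply/lee_addgt0Pr => e e0; rewrite add0e.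
  have eB : 0 < e / (B + 1) by rewrite divr_gt0// ltr_wpDl.
  apply: le_trans (ZN' ((e / (B + 1)) `^ q^-1) _ _) _.
  - by rewrite powR_gt0.
  - by rewrite N00 powR_ge0.
  rewrite lee_fin -powRrM mulVf ?gt_eqF// powRr1 ?(ltW eB)//.
  by rewrite mulrCA ler_piMr ?(ltW e0)// ler_pdivrMr ?ltr_wpDl// mul1r lerDl.
have pN0 : p != 0 by rewrite gt_eqF.
have qN0 : q != 0 by rewrite gt_eqF.
have -> : (Hdot_norm mu E s u = (h `^ 2^-1)%:E)%E.
  by rewrite /Hdot_norm Lpnorm2E hE.
rewrite LpnormE -/Z NE /C ME !poweR_EFin -!EFinM.
apply: (@le_trans _ _ ((B * N `^ q)%:E `^ p^-1)%E).
  apply: gt0_ler_poweR => //.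
  - by rewrite invr_ge0 ltW.
  - rewrite in_itv /= leey andbT; apply: integral_ge0 => x _.
    by rewrite lee_fin powR_ge0.
  - by rewrite in_itv /= leey andbT lee_fin mulr_ge0// powR_ge0.
rewrite poweR_EFin lee_fin le_eqVlt; apply/orP; left; apply/eqP.
have p2q : p - 2 = q by rewrite pq addrK.
have sq : sigma * q = 2 * s by rewrite /q; field; rewrite gt_eqF.
(* 4 * 2^q = 2^p since p = q + 2. What remains is to take p-th roots factor by factor, with 1 - 2/p
   = q/p and sigma q = 2 s. *)
have -> : B * N `^ q = 2 `^ p * M ^+ 2 * (p / q) * (2 / c) `^ (2 * s) * N `^ q * h.
  rewrite /B {2}pq powRD; last by apply/implyP; rewrite -pq (negbTE pN0).
  by rewrite -[2 `^ 2]/(2 `^ (2%:R)) powR_mulrn//; ring.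
have P1 : 0 <= 2 `^ p :> R by exact: powR_ge0.
have P2 : 0 <= M `^ 2 by exact: powR_ge0.
have P3 : 0 <= (2 / c) `^ (2 * s) by exact: powR_ge0.
have P4 : 0 <= N `^ q by exact: powR_ge0.
rewrite -powR_mulrn//.
have P5 := mulr_ge0 P1 P2; have P6 := mulr_ge0 P5 pq0; have P7 := mulr_ge0 P6 P3.
rewrite (powRM _ (mulr_ge0 P7 P4) h0) (powRM _ P7 P4) (powRM _ P6 P3) (powRM _ P5 pq0).
rewrite (powRM _ P1 P2) -!powRrM mulfV// powRr1// p2q.
have -> : 1 - 2 / p = q / p by rewrite pq; field; rewrite -pq.
have -> : 2^-1 * (2 / p) = p^-1 by field.
have -> : sigma * (q / p) = 2 * s / p by rewrite mulrA sq.
by ring.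
Qed.
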